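(* Let $F$ be a field of characteristic zero and let $L=b(2)$ be the Lie superalgebra over $F$ described in the context. Then the graded PI-exponent of $L$, i.e. the limit $exp^{gr}(L)=\lim_{n\to\infty}\sqrt[n]{c_n^{gr}(L)}$, exists and $$exp^{gr}(L)=3+2\sqrt{3}.$$
   Context: Throughout, $F$ is a field of characteristic zero. A Lie superalgebra over $F$ is a (non-associative) $\mathbb{Z}_2$-graded algebra $L=L_0\oplus L_1$ satisfying $xy+(-1)^{|x||y|}yx=0$ and $x(yz)=(xy)z+(-1)^{|x||y|}y(xz)$ for all homogeneous $x,y,z\in L_0\cup L_1$, where $|x|=0$ if $x\in L_0$ ($x$ is even) and $|x|=1$ if $x\in L_1$ ($x$ is odd). The Lie superalgebra $b(2)=L_0\oplus L_1$ is the following subspace of $M_4(F)$ (written in $2\times 2$ blocks): $$L_0=\left\{\begin{pmatrix}A&0\\0&-A^t\end{pmatrix} : A\in M_2(F),\ tr(A)=0\right\},\quad L_1=\left\{\begin{pmatrix}0&B\\C&0\end{pmatrix} : B,C\in M_2(F),\ B^t=B,\ C^t=-C\right\},$$ where $t$ denotes transpose, with product $\{x,y\}=xy-(-1)^{|x||y|}yx$ for homogeneous $x,y$ (the products on the right are associative matrix products), extended bilinearly. Graded codimensions. Let $\mathcal{L}(X,Y)$ be the free Lie superalgebra over $F$ with infinite sets of even generators $X=\{x_1,x_2,\ldots\}$ and odd generators $Y=\{y_1,y_2,\ldots\}$. A polynomial $f=f(x_1,\ldots,x_p,y_1,\ldots,y_q)\in\mathcal{L}(X,Y)$ is a graded identity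 of a Lie superalgebra $L=L_0\oplus L_1$ if $f(a_1,\ldots,a_p,b_1,\ldots,b_q)=0$ for all $a_1,\ldots,a_p\in L_0$, $b_1,\ldots,b_q\in L_1$; $Id^{gr}(L)$ is the ideal of all graded identities of $L$. For integers $0\le k\le n$, $n\ge1$, let $P_{k,n-k}\subseteq\mathcal{L}(X,Y)$ be the subspace of all multilinear polynomials in $x_1,\ldots,x_k,y_1,\ldots,y_{n-k}$. Put $P_{k,n-k}(L)=P_{k,n-k}/(P_{k,n-k}\cap Id^{gr}(L))$, $c_{k,n-k}(L)=\dim P_{k,n-k}(L)$, and define the $n$th (total) graded codimension of $L$ by $$c_n^{gr}(L)=\sum_{k=0}^n\binom{n}{k}c_{k,n-k}(L).$$ *)

(* Defs.v *)
From HB Require Import structures.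
From mathcomp Require Import all_boot all_order all_algebra.
From mathcomp Require Import mathcomp_extra boolp classical_sets.
From mathcomp Require Import ring.

Set Implicit Arguments.
Unset Strict Implicit.
Unset Printing Implicit Defensive.

Import Order.TTheory GRing.Theory Num.Theory.
Local Open Scope classical_set_scope.
Local Open Scope ring_scope.

(* Parities are booleans, [true] being odd: the sum in Z/2 is [(+)] and the
   product is [&&], so that the sign (-1)^{|x||y|} reads [(-1) ^+ (p && q)]. *)
Record lieSuperalgebra (F : fieldType) := LieSuperalgebra {
  lsa_sort :> lmodType F;
  lsa_br : lsa_sort -> lsa_sort -> lsa_sort;
  lsa_homog : bool -> set lsa_sort;
  lsa_homog0 : forall p, lsa_homog p 0;
  lsa_homogP : forall p (a : F) x y,
    lsa_homog p x -> lsa_homog p y -> lsa_homog p (a *: x + y);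
  lsa_homog_sum : forall x, exists x0 x1,
    [/\ lsa_homog false x0, lsa_homog true x1 & x = x0 + x1];
  lsa_homog_direct : forall x, lsa_homog false x -> lsa_homog true x -> x = 0;
  lsa_br_linearl : forall y, linear (lsa_br^~ y);
  lsa_br_linearr : forall x, linear (lsa_br x);
  lsa_br_homog : forall p q x y,
    lsa_homog p x -> lsa_homog q y -> lsa_homog (p (+) q) (lsa_br x y);
  lsa_br_anti : forall p q x y, lsa_homog p x -> lsa_homog q y ->
    lsa_br x y + (-1) ^+ (p && q) *: lsa_br y x = 0;
  lsa_br_jacobi : forall p q x y z, lsa_homog p x -> lsa_homog q y ->
    lsa_br x (lsa_br y z) =
    lsa_br (lsa_br x y) z + (-1) ^+ (p && q) *: lsa_br y (lsa_br x z) }.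

Arguments lsa_br {F l}.
Arguments lsa_homog {F l}.

(* A letter [(false, i)] stands for the even generator x_{i+1}, and
   [(true, i)] for the odd generator y_{i+1}. *)
Definition letter := (bool * nat)%type.

(* The free Lie superalgebra L(X, Y) is built as the term algebra for the
   signature of nonassociative F-algebras, modulo the congruence [lsa_eq]
   generated by the axioms of Lie superalgebras; [free_lsa_universal] below is
   its universal property. *)
Inductive lterm (F : Type) :=
| LGen of letter
| LZero
| LAdd of lterm F & lterm F
| LScale of F & lterm F
| LBr of lterm F & lterm F.

Arguments LGen {F}.
Arguments LZero {F}.

HB.instance Definition _ (F : Type) := gen_eqMixin (lterm F).
HB.instance Definition _ (F : Type) := gen_choiceMixin (lterm F).

Inductive lterm_homog (F : Type) : bool -> lterm F -> Prop :=
| LHomGen p i : lterm_homog p (LGen (p, i))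
| LHomZero p : lterm_homog p LZero
| LHomAdd p s t : lterm_homog p s -> lterm_homog p t -> lterm_homog p (LAdd s t)
| LHomScale p a t : lterm_homog p t -> lterm_homog p (LScale a t)
| LHomBr p q s t :
    lterm_homog p s -> lterm_homog q t -> lterm_homog (p (+) q) (LBr s t).

Inductive lsa_eq (F : fieldType) : lterm F -> lterm F -> Prop :=
| LE_refl t : lsa_eq t t
| LE_sym s t : lsa_eq s t -> lsa_eq t s
| LE_trans s t u : lsa_eq s t -> lsa_eq t u -> lsa_eq s u
| LE_cadd s s' t t' :
    lsa_eq s s' -> lsa_eq t t' -> lsa_eq (LAdd s t) (LAdd s' t')
| LE_cscale a t t' : lsa_eq t t' -> lsa_eq (LScale a t) (LScale a t')
| LE_cbr s s' t t' :
    lsa_eq s s' -> lsa_eq t t' -> lsa_eq (LBr s t) (LBr s' t')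
| LE_addA s t u : lsa_eq (LAdd s (LAdd t u)) (LAdd (LAdd s t) u)
| LE_addC s t : lsa_eq (LAdd s t) (LAdd t s)
| LE_add0 t : lsa_eq (LAdd LZero t) t
| LE_addN t : lsa_eq (LAdd (LScale (-1) t) t) LZero
| LE_scaleA a b t : lsa_eq (LScale a (LScale b t)) (LScale (a * b) t)
| LE_scale1 t : lsa_eq (LScale 1 t) t
| LE_scaleDr a s t :
    lsa_eq (LScale a (LAdd s t)) (LAdd (LScale a s) (LScale a t))
| LE_scaleDl a b t :
    lsa_eq (LScale (a + b) t) (LAdd (LScale a t) (LScale b t))
| LE_brDl s s' t : lsa_eq (LBr (LAdd s s') t) (LAdd (LBr s t) (LBr s' t))
| LE_brZl a s t : lsa_eq (LBr (LScale a s) t) (LScale a (LBr s t))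
| LE_brDr s t t' : lsa_eq (LBr s (LAdd t t')) (LAdd (LBr s t) (LBr s t'))
| LE_brZr a s t : lsa_eq (LBr s (LScale a t)) (LScale a (LBr s t))
| LE_anti p q s t : lterm_homog p s -> lterm_homog q t ->
    lsa_eq (LAdd (LBr s t) (LScale ((-1) ^+ (p && q)) (LBr t s))) LZero
| LE_jacobi p q s t u : lterm_homog p s -> lterm_homog q t ->
    lsa_eq (LBr s (LBr t u))
           (LAdd (LBr (LBr s t) u)
                 (LScale ((-1) ^+ (p && q)) (LBr t (LBr s u)))).

Section FreeLieSuperalgebra.
Variable F : fieldType.
Local Open Scope quotient_scope.

Definition lsa_eqb (s t : lterm F) : bool := `[< lsa_eq s t >].

Lemma lsa_eqb_equiv : equiv_class_of lsa_eqb.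
Proof.
split=> [t|s t|t s u]; first by apply/asboolP/LE_refl.
  by apply/idP/idP => /asboolP h; apply/asboolP/LE_sym.
by move=> /asboolP h /asboolP h'; apply/asboolP/(LE_trans h h').
Qed.

Canonical lsa_eqb_equivRel := EquivRelPack lsa_eqb_equiv.

Definition freeL := {eq_quot lsa_eqb}.
HB.instance Definition _ := Choice.on freeL.
HB.instance Definition _ := EqQuotient.on freeL.

Definition lclass (t : lterm F) : freeL := \pi_freeL t.
Definition lrepr (x : freeL) : lterm F := repr x.

Lemma lreprK x : lclass (lrepr x) = x.
Proof. exact: reprK. Qed.

Lemma lclassW (P : freeL -> Prop) : (forall t, P (lclass t)) -> forall x, P x.
Proof. by move=> h x; rewrite -[x]lreprK. Qed.

Lemma freeLP (s t : lterm F) : (lclass s = lclass t) <-> lsa_eq s t.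
Proof.
split=> [/(@eqquotP _ lsa_eqb_equivRel freeL)/asboolP //|h].
exact/(@eqquotP _ lsa_eqb_equivRel freeL)/asboolP.
Qed.

Lemma reprLP (t : lterm F) : lsa_eq (lrepr (lclass t)) t.
Proof. by apply/freeLP; rewrite lreprK. Qed.

Definition freeL_zero : freeL := lclass LZero.
Definition freeL_add (x y : freeL) : freeL := lclass (LAdd (lrepr x) (lrepr y)).
Definition freeL_scale (a : F) (x : freeL) : freeL := lclass (LScale a (lrepr x)).
Definition freeL_opp (x : freeL) : freeL := freeL_scale (-1) x.
Definition freeL_br (x y : freeL) : freeL := lclass (LBr (lrepr x) (lrepr y)).
Definition freeL_gen (l : letter) : freeL := lclass (LGen l).
Definition freeL_homog (p : bool) : set freeL :=
  [set x | exists2 t, lterm_homog p t & x = lclass t].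

Lemma piLD s t : lclass (LAdd s t) = freeL_add (lclass s) (lclass t).
Proof. by apply/freeLP/LE_sym/LE_cadd; exact: reprLP. Qed.

Lemma piLZ a t : lclass (LScale a t) = freeL_scale a (lclass t).
Proof. by apply/freeLP/LE_sym/LE_cscale; exact: reprLP. Qed.

Lemma piLB s t : lclass (LBr s t) = freeL_br (lclass s) (lclass t).
Proof. by apply/freeLP/LE_sym/LE_cbr; exact: reprLP. Qed.

Lemma freeL_addA : associative freeL_add.
Proof.
elim/lclassW=> s; elim/lclassW=> t; elim/lclassW=> u.
by rewrite -!piLD; apply/freeLP/LE_addA.
Qed.

Lemma freeL_addC : commutative freeL_add.
Proof.
by elim/lclassW=> s; elim/lclassW=> t; rewrite -!piLD; apply/freeLP/LE_addC.
Qed.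

Lemma freeL_add0 : left_id freeL_zero freeL_add.
Proof. by elim/lclassW=> t; rewrite -!piLD; apply/freeLP/LE_add0. Qed.

Lemma freeL_addN : left_inverse freeL_zero freeL_opp freeL_add.
Proof.
elim/lclassW=> t; rewrite /freeL_opp -piLZ -!piLD; exact/freeLP/LE_addN.
Qed.

HB.instance Definition _ :=
  GRing.isZmodule.Build freeL freeL_addA freeL_addC freeL_add0 freeL_addN.

Lemma freeL_scaleA a b x :
  freeL_scale a (freeL_scale b x) = freeL_scale (a * b) x.
Proof. by elim/lclassW: x => t; rewrite -!piLZ; apply/freeLP/LE_scaleA. Qed.

Lemma freeL_scale1 : left_id 1 freeL_scale.
Proof. by elim/lclassW=> t; rewrite -!piLZ; apply/freeLP/LE_scale1. Qed.

Lemma freeL_scaleDr : right_distributive freeL_scale +%R.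
Proof.
move=> a; elim/lclassW=> s; elim/lclassW=> t.
by rewrite -[X in freeL_scale _ X]piLD -!piLZ -[RHS]piLD;
  apply/freeLP/LE_scaleDr.
Qed.

Lemma freeL_scaleDl x : {morph freeL_scale^~ x : a b / a + b}.
Proof.
by elim/lclassW: x => t a b; rewrite -!piLZ -[RHS]piLD; apply/freeLP/LE_scaleDl.
Qed.

HB.instance Definition _ := GRing.Zmodule_isLmodule.Build F freeL
  freeL_scaleA freeL_scale1 freeL_scaleDr freeL_scaleDl.

Lemma piL0 : lclass LZero = 0. Proof. by []. Qed.
Lemma piLDE s t : lclass (LAdd s t) = lclass s + lclass t.
Proof. exact: piLD. Qed.
Lemma piLZE a t : lclass (LScale a t) = a *: lclass t.
Proof. exact: piLZ. Qed.

Lemma freeL_homog0 p : freeL_homog p 0.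
Proof. by exists LZero => //; constructor. Qed.

Lemma freeL_homogP p (a : F) x y :
  freeL_homog p x -> freeL_homog p y -> freeL_homog p (a *: x + y).
Proof.
move=> [s hs ->] [t ht ->]; exists (LAdd (LScale a s) t).
  by do 2?constructor.
by rewrite piLDE piLZE.
Qed.

Lemma freeL_homogZ p (a : F) x : freeL_homog p x -> freeL_homog p (a *: x).
Proof. by rewrite -[a *: x]addr0 => h; apply: freeL_homogP h (freeL_homog0 p). Qed.

Lemma freeL_homogD p x y :
  freeL_homog p x -> freeL_homog p y -> freeL_homog p (x + y).
Proof. by rewrite -{2}[x]scale1r; apply: freeL_homogP. Qed.

Lemma freeL_br_linearl y : linear (freeL_br^~ y).
Proof.
elim/lclassW: y => u a; elim/lclassW=> s; elim/lclassW=> t.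
rewrite -[X in freeL_br (X + _)]piLZE -[X in freeL_br X]piLDE -!piLB -piLZE.
rewrite -piLDE; apply/freeLP; apply: LE_trans (LE_brDl _ _ _) _.
by apply: LE_cadd (LE_refl _); apply: LE_brZl.
Qed.

Lemma freeL_br_linearr x : linear (freeL_br x).
Proof.
elim/lclassW: x => u a; elim/lclassW=> s; elim/lclassW=> t.
rewrite -[X in freeL_br _ (X + _)]piLZE -[X in freeL_br _ X]piLDE -!piLB -piLZE.
rewrite -piLDE; apply/freeLP; apply: LE_trans (LE_brDr _ _ _) _.
by apply: LE_cadd (LE_refl _); apply: LE_brZr.
Qed.

Lemma freeL_br_homog p q x y :
  freeL_homog p x -> freeL_homog q y -> freeL_homog (p (+) q) (freeL_br x y).
Proof.
move=> [s hs ->] [t ht ->]; exists (LBr s t); first by constructor.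
by rewrite piLB.
Qed.

Lemma freeL_br_anti p q x y : freeL_homog p x -> freeL_homog q y ->
  freeL_br x y + (-1) ^+ (p && q) *: freeL_br y x = 0.
Proof.
move=> [s hs ->] [t ht ->].
by rewrite -!piLB -piLZE -piLDE; apply/freeLP/LE_anti.
Qed.

Lemma freeL_br_jacobi p q x y z : freeL_homog p x -> freeL_homog q y ->
  freeL_br x (freeL_br y z) =
  freeL_br (freeL_br x y) z + (-1) ^+ (p && q) *: freeL_br y (freeL_br x z).
Proof.
move=> [s hs ->] [t ht ->]; elim/lclassW: z => u.
by rewrite -!piLB -piLZE -piLDE; apply/freeLP/LE_jacobi.
Qed.

Lemma freeL_ind (P : freeL -> Prop) :
  (forall l, P (freeL_gen l)) -> P 0 ->
  (forall x y, P x -> P y -> P (x + y)) ->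
  (forall a x, P x -> P (a *: x)) ->
  (forall x y, P x -> P y -> P (freeL_br x y)) -> forall x, P x.
Proof.
move=> Pg P0 PD PZ PB; elim/lclassW; elim=> // [s ? t ?|a t ?|s ? t ?].
- by rewrite piLDE; apply: PD.
- by rewrite piLZE; apply: PZ.
- by rewrite piLB; apply: PB.
Qed.

Lemma freeL_brDl x y z : freeL_br (x + y) z = freeL_br x z + freeL_br y z.
Proof. by rewrite -[x in LHS]scale1r freeL_br_linearl scale1r. Qed.

Lemma freeL_brDr x y z : freeL_br z (x + y) = freeL_br z x + freeL_br z y.
Proof. by rewrite -[x in LHS]scale1r freeL_br_linearr scale1r. Qed.

Lemma freeL_br0l z : freeL_br 0 z = 0.
Proof. by apply: (@addrI _ (freeL_br 0 z)); rewrite -freeL_brDl !addr0. Qed.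

Lemma freeL_br0r z : freeL_br z 0 = 0.
Proof. by apply: (@addrI _ (freeL_br z 0)); rewrite -freeL_brDr !addr0. Qed.

Lemma freeL_homog_sum x : exists x0 x1,
  [/\ freeL_homog false x0, freeL_homog true x1 & x = x0 + x1].
Proof.
elim/freeL_ind: x => [[p i]||x y|a x|x y].
- have hg : freeL_homog p (freeL_gen (p, i)).
    by exists (LGen (p, i)); first exact: LHomGen.
  by case: p hg => hg; [exists 0, (freeL_gen (true, i))
    |exists (freeL_gen (false, i)), 0]; rewrite ?add0r ?addr0; split=> //;
    apply: freeL_homog0.
- by exists 0, 0; rewrite addr0; split=> //; apply: freeL_homog0.
- move=> [x0 [x1 [h0 h1 ->]]] [y0 [y1 [k0 k1 ->]]].
  by exists (x0 + y0), (x1 + y1); rewrite addrACA; split=> //;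
    apply: freeL_homogD.
- move=> [x0 [x1 [h0 h1 ->]]].
  by exists (a *: x0), (a *: x1); rewrite scalerDr; split=> //;
    apply: freeL_homogZ.
- move=> [x0 [x1 [h0 h1 ->]]] [y0 [y1 [k0 k1 ->]]].
  exists (freeL_br x0 y0 + freeL_br x1 y1), (freeL_br x0 y1 + freeL_br x1 y0).
  split.
  + by apply: freeL_homogD;
      [apply: (freeL_br_homog h0 k0)|apply: (freeL_br_homog h1 k1)].
  + by apply: freeL_homogD;
      [apply: (freeL_br_homog h0 k1)|apply: (freeL_br_homog h1 k0)].
  + rewrite freeL_brDl !freeL_brDr -!addrA; congr (_ + _).
    by rewrite [RHS]addrC -addrA.
Qed.

(* Component of parity [p] of a term, used to see that the grading of [freeL]
   is direct. *)
Fixpoint lterm_part (p : bool) (t : lterm F) : freeL :=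
  match t with
  | LGen l => if l.1 == p then freeL_gen l else 0
  | LZero => 0
  | LAdd s t => lterm_part p s + lterm_part p t
  | LScale a t => a *: lterm_part p t
  | LBr s t => freeL_br (lterm_part false s) (lterm_part p t) +
               freeL_br (lterm_part true s) (lterm_part (~~ p) t)
  end.

Lemma lterm_part_homog p q t : lterm_homog q t ->
  lterm_part p t = if q == p then lclass t else 0.
Proof.
move=> h; elim: h p => {q t}.
- by move=> q i p.
- by move=> q p /=; case: eqP; rewrite ?piL0.
- by move=> q s t _ IHs _ IHt p /=; rewrite IHs IHt; case: eqP;
    rewrite ?addr0 // piLDE.
- by move=> q a t _ IHt p /=; rewrite IHt; case: eqP;
    rewrite ?scaler0 // piLZE.
- move=> q r s t _ IHs _ IHt p /=; rewrite !IHs !IHt piLB.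
  by case: q {IHs}; case: r {IHt}; case: p => /=;
    rewrite ?freeL_br0l ?freeL_br0r ?addr0 ?add0r.
Qed.

Lemma lterm_part_hom p t : freeL_homog p (lterm_part p t).
Proof.
elim: t p => [[q i]||s IHs t IHt|a t IHt|s IHs t IHt] p /=.
- case: eqP => [->|_]; last exact: freeL_homog0.
  by exists (LGen (p, i)); first exact: LHomGen.
- exact: freeL_homog0.
- exact: freeL_homogD.
- exact: freeL_homogZ.
- apply: freeL_homogD; first exact: (freeL_br_homog (IHs false) (IHt p)).
  by have := freeL_br_homog (IHs true) (IHt (~~ p)); case: (p).
Qed.

Lemma lterm_part_eq p s t : lsa_eq s t -> lterm_part p s = lterm_part p t.
Proof.
have brZl a x y : freeL_br (a *: x) y = a *: freeL_br x y.
  by rewrite -[a *: x]addr0 freeL_br_linearl freeL_br0l addr0.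
have brZr a x y : freeL_br x (a *: y) = a *: freeL_br x y.
  by rewrite -[a *: y]addr0 freeL_br_linearr freeL_br0r addr0.
move=> h; elim: h p => {s t} //=.
- by move=> s t u _ IH1 _ IH2 p; rewrite IH1.
- by move=> s s' t t' _ IH1 _ IH2 p; rewrite IH1 IH2.
- by move=> a t t' _ IH p; rewrite IH.
- by move=> s s' t t' _ IH1 _ IH2 p; rewrite !IH1 !IH2.
- by move=> s t u p; rewrite addrA.
- by move=> s t p; rewrite addrC.
- by move=> t p; rewrite add0r.
- by move=> t p; rewrite scaleN1r addNr.
- by move=> a b t p; rewrite scalerA.
- by move=> t p; rewrite scale1r.
- by move=> a s t p; rewrite scalerDr.
- by move=> a b t p; rewrite scalerDl.
- by move=> s s' t p; rewrite !freeL_brDl addrACA.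
- by move=> a s t p; rewrite !brZl scalerDr.
- by move=> s t t' p; rewrite !freeL_brDr addrACA.
- by move=> a s t p; rewrite !brZr scalerDr.
- move=> q r s t hs ht p.
  rewrite !(lterm_part_homog _ hs) !(lterm_part_homog _ ht).
  have := freeL_br_anti (ex_intro2 _ _ _ hs erefl) (ex_intro2 _ _ _ ht erefl).
  by case: q {hs}; case: r {ht}; case: p => /= H;
    rewrite ?(freeL_br0l, freeL_br0r, addr0, add0r, scaler0).
- move=> q r s t u hs ht p.
  rewrite !(lterm_part_homog _ hs) !(lterm_part_homog _ ht).
  have H v := freeL_br_jacobi v
    (ex_intro2 _ _ _ hs erefl) (ex_intro2 _ _ _ ht erefl).
  by case: q {hs} H; case: r {ht}; case: p => /= H;
    rewrite ?(freeL_br0l, freeL_br0r, addr0, add0r, scaler0) H.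
Qed.

Lemma freeL_homog_direct x : freeL_homog false x -> freeL_homog true x -> x = 0.
Proof.
move=> [s hs ->] [t ht] /freeLP /(lterm_part_eq false).
by rewrite (lterm_part_homog _ hs) (lterm_part_homog _ ht).
Qed.

Definition free_lsa : lieSuperalgebra F :=
  @LieSuperalgebra F freeL freeL_br freeL_homog freeL_homog0 freeL_homogP
    freeL_homog_sum freeL_homog_direct freeL_br_linearl freeL_br_linearr
    freeL_br_homog freeL_br_anti freeL_br_jacobi.

Definition free_gen (l : letter) : free_lsa := freeL_gen l.

End FreeLieSuperalgebra.

Arguments free_gen {F}.

Section GradedIdentities.
Variables (F : fieldType) (L : lieSuperalgebra F).

Fixpoint lterm_eval (a : letter -> L) (t : lterm F) : L :=
  match t with
  | LGen l => a l
  | LZero => 0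
  | LAdd s t => lterm_eval a s + lterm_eval a t
  | LScale c t => c *: lterm_eval a t
  | LBr s t => lsa_br (lterm_eval a s) (lterm_eval a t)
  end.

Definition graded_subst (a : letter -> L) : Prop :=
  forall l, lsa_homog l.1 (a l).

(* Evaluation f(a) of f at a graded substitution; by [lterm_eval_eq] it does
   not depend on the representative of f. *)
Definition free_eval (a : letter -> L) (f : free_lsa F) : L :=
  lterm_eval a (lrepr f).

Definition graded_Id : set (free_lsa F) :=
  [set f | forall a, graded_subst a -> free_eval a f = 0].

Lemma lsa_homogZ p (c : F) (x : L) : lsa_homog p x -> lsa_homog p (c *: x).
Proof. by rewrite -[c *: x]addr0 => h; apply: lsa_homogP h (lsa_homog0 L p). Qed.

Lemma lsa_homogD p (x y : L) :
  lsa_homog p x -> lsa_homog p y -> lsa_homog p (x + y).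
Proof. by rewrite -{2}[x]scale1r; apply: lsa_homogP. Qed.

Lemma lterm_eval_homog a p t :
  graded_subst a -> lterm_homog p t -> lsa_homog p (lterm_eval a t).
Proof.
move=> ga; elim=> {p t} /=.
- by move=> p i; apply: (ga (p, i)).
- by move=> p; apply: lsa_homog0.
- by move=> p s t _ hs _ ht; apply: lsa_homogD.
- by move=> p c t _; apply: lsa_homogZ.
- by move=> p q s t _ hs _ ht; apply: lsa_br_homog.
Qed.

Lemma lsa_brDl (x y z : L) : lsa_br (x + y) z = lsa_br x z + lsa_br y z.
Proof. by rewrite -[x in LHS]scale1r lsa_br_linearl scale1r. Qed.

Lemma lsa_brDr (x y z : L) : lsa_br z (x + y) = lsa_br z x + lsa_br z y.
Proof. by rewrite -[x in LHS]scale1r lsa_br_linearr scale1r. Qed.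

Lemma lsa_br0l (z : L) : lsa_br 0 z = 0.
Proof. by apply: (@addrI _ (lsa_br 0 z)); rewrite -lsa_brDl !addr0. Qed.

Lemma lsa_br0r (z : L) : lsa_br z 0 = 0.
Proof. by apply: (@addrI _ (lsa_br z 0)); rewrite -lsa_brDr !addr0. Qed.

Lemma lsa_brZl c (x y : L) : lsa_br (c *: x) y = c *: lsa_br x y.
Proof. by rewrite -[c *: x]addr0 lsa_br_linearl lsa_br0l addr0. Qed.

Lemma lsa_brZr c (x y : L) : lsa_br x (c *: y) = c *: lsa_br x y.
Proof. by rewrite -[c *: y]addr0 lsa_br_linearr lsa_br0r addr0. Qed.

Lemma lterm_eval_eq a s t :
  graded_subst a -> lsa_eq s t -> lterm_eval a s = lterm_eval a t.
Proof.
move=> ga; elim=> {s t} //=.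
- by move=> s t u _ IH1 _ IH2; rewrite IH1.
- by move=> s s' t t' _ IH1 _ IH2; rewrite IH1 IH2.
- by move=> c t t' _ IH; rewrite IH.
- by move=> s s' t t' _ IH1 _ IH2; rewrite IH1 IH2.
- by move=> s t u; rewrite addrA.
- by move=> s t; rewrite addrC.
- by move=> t; rewrite add0r.
- by move=> t; rewrite scaleN1r addNr.
- by move=> c d t; rewrite scalerA.
- by move=> t; rewrite scale1r.
- by move=> c s t; rewrite scalerDr.
- by move=> c d t; rewrite scalerDl.
- by move=> s s' t; rewrite lsa_brDl.
- by move=> c s t; rewrite lsa_brZl.
- by move=> s t t'; rewrite lsa_brDr.
- by move=> c s t; rewrite lsa_brZr.
- by move=> p q s t hs ht; apply: lsa_br_anti; apply: lterm_eval_homog.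
- by move=> p q s t u hs ht; apply: lsa_br_jacobi; apply: lterm_eval_homog.
Qed.

Definition even_morphism (phi : free_lsa F -> L) : Prop :=
  [/\ linear phi, (forall x y, phi (lsa_br x y) = lsa_br (phi x) (phi y))
    & forall p x, lsa_homog p x -> lsa_homog p (phi x)].

Lemma free_eval_pi a t :
  graded_subst a -> free_eval a (lclass t) = lterm_eval a t.
Proof. by move=> ga; apply: lterm_eval_eq => //; apply: reprLP. Qed.

Lemma free_eval_gen a l : graded_subst a -> free_eval a (free_gen l) = a l.
Proof. by move=> ga; rewrite [LHS]free_eval_pi. Qed.

Lemma free_eval_morphism a : graded_subst a -> even_morphism (free_eval a).
Proof.
move=> ga; split.
- move=> c; elim/lclassW=> s; elim/lclassW=> t.
  have -> : c *: (lclass s) + (lclass t) =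
            (lclass (LAdd (LScale c s) t)).
    by rewrite piLDE piLZE.
  by rewrite !free_eval_pi.
- elim/lclassW=> s; elim/lclassW=> t.
  have -> : @lsa_br _ (free_lsa F) (lclass s) (lclass t) =
            (lclass (LBr s t)).
    by rewrite piLB.
  by rewrite !free_eval_pi.
- by move=> p x [t ht ->]; rewrite free_eval_pi //; apply: lterm_eval_homog.
Qed.

Theorem free_lsa_universal a : graded_subst a ->
  even_morphism (free_eval a) /\ (forall l, free_eval a (free_gen l) = a l) /\
  forall phi, even_morphism phi -> (forall l, phi (free_gen l) = a l) ->
    forall f, phi f = free_eval a f.
Proof.
move=> ga; have em := free_eval_morphism ga; split=> //; split.
  by move=> l; apply: free_eval_gen.
move=> phi [lphi mphi _] gphi f; case: em => le me _.
have z0 (g : free_lsa F -> L) : linear g -> g 0 = 0.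
  move=> lg; have := lg 1 0 0; rewrite scaler0 addr0 scale1r => /esym/eqP.
  by rewrite -subr_eq0 addrK => /eqP.
elim/freeL_ind: f.
- by move=> l; rewrite [LHS]gphi [RHS]free_eval_gen.
- by rewrite [LHS]z0 // [RHS]z0.
- by move=> x y IHx IHy; rewrite -[x]scale1r [LHS]lphi [RHS]le IHx IHy.
- move=> c x IHx; rewrite -[c *: x]addr0 [LHS]lphi [RHS]le IHx.
  by rewrite [phi _]z0 // [free_eval a 0]z0.
- by move=> x y IHx IHy; rewrite [LHS]mphi [RHS]me IHx IHy.
Qed.

End GradedIdentities.

Section Codimensions.
Variable F : fieldType.

Definition lspan (V : lmodType F) (S : set V) : set V :=
  [set v | exists (m : nat) (c : 'I_m -> F) (u : 'I_m -> V),
    (forall i, S (u i)) /\ v = \sum_i c i *: u i].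

(* dim (U / W) = d for subspaces W of U: some d elements of U form a basis
   of U modulo W. *)
Definition quo_dim (V : lmodType F) (U W : set V) (d : nat) : Prop :=
  exists b : 'I_d -> V,
    [/\ forall i, U (b i),
        forall c : 'I_d -> F, W (\sum_i c i *: b i) -> forall i, c i = 0
      & forall v, U v -> exists c : 'I_d -> F, W (v - \sum_i c i *: b i)].

(* Nonassociative words in the generators. *)
Inductive word := Letter of letter | Prod of word & word.

Fixpoint letters (w : word) : seq letter :=
  match w with
  | Letter l => [:: l]
  | Prod w1 w2 => letters w1 ++ letters w2
  end.

Fixpoint monomial (w : word) : free_lsa F :=
  match w with
  | Letter l => free_gen l
  | Prod w1 w2 => lsa_br (monomial w1) (monomial w2)
  end.

Definition multi_letters (k q : nat) : seq letter :=
  [seq (false, i) | i <- iota 0 k] ++ [seq (true, j) | j <- iota 0 q].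

(* P_{k,q}: the span of the monomials in which each of x_1, ..., x_k,
   y_1, ..., y_q occurs exactly once, and no other generator does. *)
Definition multilinear (k q : nat) : set (free_lsa F) :=
  lspan [set f | exists2 w, perm_eq (letters w) (multi_letters k q)
                          & f = monomial w].

(* [xget 0] picks the dimension, which exists and is unique by
   [partial_codimP] and [quo_dim_unique]. *)
Definition partial_codim (L : lieSuperalgebra F) (k q : nat) : nat :=
  xget 0 [set d | quo_dim (multilinear k q)
                          (multilinear k q `&` graded_Id L) d].

Definition gr_codim (L : lieSuperalgebra F) (n : nat) : nat :=
  (\sum_(k < n.+1) 'C(n, k) * partial_codim L k (n - k))%N.

Definition subspace (V : lmodType F) (W : set V) : Prop :=
  W 0 /\ forall (a : F) u v, W u -> W v -> W (a *: u + v).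

Lemma subspace_lin (V : lmodType F) (W : set V) m (c : 'I_m -> F) (u : 'I_m -> V) :
  subspace W -> (forall i, W (u i)) -> W (\sum_i c i *: u i).
Proof.
move=> [W0 WP] Wu; elim/big_ind: _ => // [x y Wx Wy|i _].
  by rewrite -[x]scale1r; apply: WP.
by rewrite -[_ *: _]addr0; apply: WP.
Qed.

Lemma subspaceZ (V : lmodType F) (W : set V) a u :
  subspace W -> W u -> W (a *: u).
Proof. by move=> [W0 WP] Wu; rewrite -[_ *: _]addr0; apply: WP. Qed.

Lemma subspaceD (V : lmodType F) (W : set V) u v :
  subspace W -> W u -> W v -> W (u + v).
Proof. by move=> [W0 WP] Wu Wv; rewrite -[u]scale1r; apply: WP. Qed.

Lemma subspaceB (V : lmodType F) (W : set V) u v :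
  subspace W -> W u -> W v -> W (u - v).
Proof.
by move=> sW Wu Wv; apply: subspaceD => //; rewrite -scaleN1r; apply: subspaceZ.
Qed.

Lemma lspan_subspace (V : lmodType F) (S : set V) : subspace (lspan S).
Proof.
split.
  exists 0, (fun=> 0), (fun=> 0); split; first by case.
  by rewrite big_ord0.
move=> a _ _ [m [c [u [Su ->]]]] [n [d [v [Sv ->]]]].
exists (m + n)%N.
exists (fun i => match split i with inl j => a * c j | inr j => d j end).
exists (fun i => match split i with inl j => u j | inr j => v j end).
split; first by move=> i; case: (split i).
rewrite big_split_ord /= scaler_sumr; congr (_ + _); apply: eq_bigr => i _.
  by rewrite (unsplitK (inl i)) scalerA.
by rewrite (unsplitK (inr i)).
Qed.

Lemma lin_trans (V : lmodType F) d e (n : 'I_e -> F) (m : 'I_e -> 'I_d -> F)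
    (b : 'I_d -> V) :
  \sum_j n j *: (\sum_i m j i *: b i) = \sum_i (\sum_j n j * m j i) *: b i.
Proof.
under eq_bigr do rewrite scaler_sumr.
rewrite exchange_big /=; apply: eq_bigr => i _.
by rewrite scaler_suml; apply: eq_bigr => j _; rewrite scalerA.
Qed.

Lemma quo_dim_unique (V : lmodType F) (U W : set V) d e : subspace W ->
  quo_dim U W d -> quo_dim U W e -> d = e.
Proof.
move=> sW; suff H d' e' : quo_dim U W d' -> quo_dim U W e' -> (d' <= e')%N.
  by move=> hd he; apply/eqP; rewrite eqn_leq (H _ _ hd he) (H _ _ he hd).
move=> [b [Ub fb _]] [b' [_ _ gb']].
have /choice[m mP] : forall i, exists c : 'I_e' -> F,
    W (b i - \sum_j c j *: b' j) by move=> i; apply: gb'.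
pose M : 'M[F]_(d', e') := \matrix_(i, j) m i j.
suff /eqP <- : row_free M by apply: rank_leq_col.
apply/row_freeP; apply/row_freeP; rewrite -kermx_eq0.
apply/eqP/row_matrixP => r; set c := row r (kermx M).
have cM : c *m M = 0 by rewrite -row_mul mulmx_ker row0.
rewrite row0; apply/rowP => i; rewrite [RHS]mxE.
apply: (fb (fun i => c 0 i)) i.
have -> : \sum_i c 0 i *: b i =
    \sum_i c 0 i *: (b i - \sum_j m i j *: b' j).
  under [RHS]eq_bigr do rewrite scalerBr.
  rewrite sumrB lin_trans [X in _ - X]big1 ?subr0 // => j _.
  have := congr1 (fun X : 'rV_e' => X 0 j) cM; rewrite !mxE => cMj.
  rewrite -[RHS](scale0r (b' j)) -[in RHS]cMj; congr (_ *: _).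
  by apply: eq_bigr => k _; rewrite !mxE.
exact: subspace_lin.
Qed.

Lemma quo_dim_exists (V : lmodType F) (U W S : set V) (s : seq V) :
  subspace U -> subspace W -> (forall v, S v -> U v) ->
  (forall v, S v -> v \in (s : seq V)) -> (forall v, U v -> lspan S v) ->
  exists d, quo_dim U W d.
Proof.
move=> sU sW SU Ss US.
suff [d [b [Ub fb gb]]] : exists d, exists b : 'I_d -> V,
    [/\ forall i, U (b i),
        forall c : 'I_d -> F, W (\sum_i c i *: b i) -> forall i, c i = 0
      & forall v, v \in s -> U v ->
          exists c : 'I_d -> F, W (v - \sum_i c i *: b i)].
  exists d, b; split=> // v /US[m [c [u [Su ->]]]].
  have /choice[n nP] : forall i, exists c : 'I_d -> F,
    W (u i - \sum_j c j *: b j) by move=> i; apply: gb; [apply: Ss|apply: SU].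
  exists (fun j => \sum_i c i * n i j).
  rewrite -lin_trans -sumrB.
  under eq_bigr do rewrite -scalerBr.
  exact: subspace_lin.
elim: s {Ss} => [|v s [d [b [Ub fb gb]]]].
  by exists 0%N, (fun=> 0); split=> [[]|c _ []|].
have [[c cP]|nv] := pselect (exists c : 'I_d -> F, W (v - \sum_i c i *: b i)).
  exists d, b; split=> // w; rewrite inE => /orP[/eqP-> _|]; first by exists c.
  exact: gb.
have [Uv|nUv] := pselect (U v); last first.
  by exists d, b; split=> // w; rewrite inE => /orP[/eqP->|]; last exact: gb.
pose b' (i : 'I_d.+1) := if unlift ord0 i is Some j then b j else v.
have sb' c : \sum_i c i *: b' i =
    c ord0 *: v + \sum_j c (lift ord0 j) *: b j.
  rewrite big_ord_recl /b' unlift_none; congr (_ + _).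
  by apply: eq_bigr => j _; rewrite liftK.
exists d.+1, b'; split.
- by move=> i; rewrite /b'; case: unliftP.
- move=> c; rewrite sb' => Wc.
  have c0 : c ord0 = 0.
    apply/eqP/negPn/negP => c0; apply: nv.
    exists (fun j => - (c ord0)^-1 * c (lift ord0 j)).
    have := subspaceZ (c ord0)^-1 sW Wc.
    rewrite scalerDr scalerA mulVf // scale1r scaler_sumr.
    congr (W (_ + _)); rewrite -sumrN; apply: eq_bigr => j _.
    by rewrite mulNr scaleNr opprK scalerA.
  move: Wc; rewrite c0 scale0r add0r => /fb cj i.
  by case: (unliftP ord0 i) => [j ->|->].
- move=> w; rewrite inE => /orP[/eqP-> _|ws Uw].
    exists (fun i => (i == ord0)%:R); rewrite sb' eqxx scale1r big1 ?addr0 ?subrr.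
      by case: sW.
    by move=> j _; rewrite scale0r.
  have [c cP] := gb _ ws Uw.
  exists (fun i => if unlift ord0 i is Some j then c j else 0).
  rewrite sb' unlift_none scale0r add0r.
  by under eq_bigr do rewrite liftK.
Qed.

Fixpoint words (s : seq letter) (n : nat) : seq (free_lsa F) :=
  if n is n'.+1 then
    [seq free_gen l | l <- s] ++
    [seq lsa_br x y | x <- words s n', y <- words s n']
  else [::].

Lemma wordsP s w : (forall l, l \in letters w -> l \in s) ->
  forall n, (size (letters w) <= n)%N -> monomial w \in words s n.
Proof.
have sz w' : (0 < size (letters w'))%N.
  by elim: w' => //= w1 h1 w2 h2; rewrite size_cat addn_gt0 h1.
elim: w => [l|w1 IH1 w2 IH2] ls [|n].
- by [].
- by move=> _ /=; rewrite mem_cat map_f // ls // inE.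
- by rewrite leqNgt (sz (Prod w1 w2)).
- move=> /=; rewrite size_cat mem_cat => le.
  have l1 := sz w1; have l2 := sz w2.
  apply/orP; right; apply: allpairs_f.
    apply: IH1; first by move=> l ll; apply: ls; rewrite /= mem_cat ll.
    by rewrite -ltnS (leq_trans _ le) // -addn1 leq_add2l.
  apply: IH2; first by move=> l ll; apply: ls; rewrite /= mem_cat ll orbT.
  by rewrite -ltnS (leq_trans _ le) // -add1n leq_add2r.
Qed.

Lemma graded_Id_subspace (L : lieSuperalgebra F) : subspace (graded_Id L).
Proof.
have lin a : graded_subst a -> linear (@free_eval F L a).
  by move=> ga; have [] := free_eval_morphism ga.
split=> [a ga|c f g hf hg a ga].
  by rewrite /free_eval (lterm_eval_eq ga (reprLP _)).
by rewrite (lin a ga) hf // hg // scaler0 addr0.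
Qed.

Lemma partial_codimP (L : lieSuperalgebra F) k q :
  quo_dim (multilinear k q) (multilinear k q `&` graded_Id L)
    (partial_codim L k q).
Proof.
pose S : set (free_lsa F) :=
  [set f | exists2 w, perm_eq (letters w) (multi_letters k q) & f = monomial w].
have sU : subspace (multilinear k q) by exact: (lspan_subspace S).
have [I0 IP] := graded_Id_subspace L.
apply: xgetPex.
have := @quo_dim_exists _ (multilinear k q)
  (multilinear k q `&` graded_Id L) S
  (words (multi_letters k q) (size (multi_letters k q))) sU.
apply=> //.
- split; first by split=> //; case: sU.
  by move=> a u v [Uu Iu] [Uv Iv]; split; [apply: (proj2 sU)|apply: IP].
- move=> v Sv; exists 1%N, (fun=> 1), (fun=> v); split=> //.
  by rewrite big_ord1 scale1r.
- move=> _ [w pw ->]; apply: wordsP; last by rewrite (perm_size pw).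
  by move=> l; rewrite (perm_mem pw).
Qed.

End Codimensions.

Section B2.
Variable F : fieldType.
Notation M4 := 'M[F]_(2 + 2).

Definition b2_L0 : set M4 :=
  [set x | exists2 A : 'M[F]_2, \tr A = 0 & x = block_mx A 0 0 (- A^T)].

Definition b2_L1 : set M4 :=
  [set x | exists B C : 'M[F]_2,
    [/\ B^T = B, C^T = - C & x = block_mx 0 B C 0]].

Definition b2_homog (p : bool) : set M4 := if p then b2_L1 else b2_L0.

Definition b2_mem : {pred M4} :=
  [pred x | `[< exists x0 x1, [/\ b2_L0 x0, b2_L1 x1 & x = x0 + x1] >]].

(* Components of a matrix for the grading of M_4(F) by 2 x 2 blocks, and the
   bilinear extension of xy - (-1)^{|x||y|} yx. *)
Definition mx_part (p : bool) (x : M4) : M4 :=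
  if p then block_mx 0 (ursubmx x) (dlsubmx x) 0
  else block_mx (ulsubmx x) 0 0 (drsubmx x).

Definition super_comm (x y : M4) : M4 :=
  \sum_(p : bool) \sum_(q : bool)
    (mx_part p x *m mx_part q y - (-1) ^+ (p && q) *: (mx_part q y *m mx_part p x)).

Lemma b2_homogP p (a : F) x y :
  b2_homog p x -> b2_homog p y -> b2_homog p (a *: x + y).
Proof.
case: p => /=.
  move=> [B [C [hB hC ->]]] [B' [C' [hB' hC' ->]]].
  exists (a *: B + B'), (a *: C + C'); split.
  - by rewrite linearP /= hB hB'.
  - by rewrite linearP /= hC hC' scalerN opprD.
  - by rewrite scale_block_mx add_block_mx !scaler0 !addr0.
move=> [A hA ->] [A' hA' ->]; exists (a *: A + A').
  by rewrite linearP /= hA hA' mulr0 addr0.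
by rewrite scale_block_mx add_block_mx !scaler0 !addr0 linearP /= scalerN opprD.
Qed.

Lemma b2_homog0 p : b2_homog p 0.
Proof.
case: p => /=.
  by exists 0, 0; rewrite trmx0 oppr0; split=> //; rewrite block_mx0.
by exists 0; rewrite ?mxtrace0 // trmx0 oppr0 block_mx0.
Qed.

Lemma b2_memP x :
  reflect (exists x0 x1, [/\ b2_L0 x0, b2_L1 x1 & x = x0 + x1]) (x \in b2_mem).
Proof. exact: asboolP. Qed.

Lemma b2_homog_mem p x : b2_homog p x -> x \in b2_mem.
Proof.
move=> h; apply/b2_memP; case: p h => h.
  by exists 0, x; rewrite add0r; split=> //; apply: (b2_homog0 false).
by exists x, 0; rewrite addr0; split=> //; apply: (b2_homog0 true).
Qed.

Lemma b2_submod : submod_closed b2_mem.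
Proof.
split=> [|a _ _ /b2_memP[x0 [x1 [h0 h1 ->]]] /b2_memP[y0 [y1 [k0 k1 ->]]]].
  exact: (b2_homog_mem (b2_homog0 false)).
apply/b2_memP; exists (a *: x0 + y0), (a *: x1 + y1); split.
- exact: (@b2_homogP false).
- exact: (@b2_homogP true).
- by rewrite scalerDr addrACA.
Qed.

HB.instance Definition _ := GRing.isSubmodClosed.Build F M4 b2_mem b2_submod.

Record b2_type := B2 { b2_val : M4; b2_valP : b2_val \in b2_mem }.

HB.instance Definition _ := [isSub for b2_val].
HB.instance Definition _ := [Choice of b2_type by <:].
HB.instance Definition _ := [SubChoice_isSubLmodule of b2_type by <:].

Lemma mx_part_linear p : linear (mx_part p).
Proof.
move=> a x y; have ulP : ulsubmx (a *: x + y) = a *: ulsubmx x + ulsubmx y.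
  by apply/matrixP => i j; rewrite !mxE.
have urP : ursubmx (a *: x + y) = a *: ursubmx x + ursubmx y.
  by apply/matrixP => i j; rewrite !mxE.
have dlP : dlsubmx (a *: x + y) = a *: dlsubmx x + dlsubmx y.
  by apply/matrixP => i j; rewrite !mxE.
have drP : drsubmx (a *: x + y) = a *: drsubmx x + drsubmx y.
  by apply/matrixP => i j; rewrite !mxE.
case: p; rewrite /mx_part ?(ulP, urP, dlP, drP);
  by rewrite scale_block_mx add_block_mx !scaler0 !addr0.
Qed.

Lemma mx_part_homog p q x : b2_homog p x -> mx_part q x = if p == q then x else 0.
Proof.
by case: p => /= [[B [C [_ _ ->]]]|[A _ ->]]; case: q => /=;
  rewrite ?block_mxKul ?block_mxKur ?block_mxKdl ?block_mxKdr ?block_mx0.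
Qed.

Lemma super_commE p q x y : b2_homog p x -> b2_homog q y ->
  super_comm x y = x *m y - (-1) ^+ (p && q) *: (y *m x).
Proof.
move=> hx hy; rewrite /super_comm !big_bool.
rewrite !(mx_part_homog _ hx) !(mx_part_homog _ hy).
by case: p {hx}; case: q {hy} => /=;
  rewrite ?mul0mx ?mulmx0 ?scaler0 ?subr0 ?addr0 ?add0r.
Qed.

Lemma super_comm_linearl y : linear (super_comm^~ y).
Proof.
move=> a x x'; rewrite /super_comm !big_bool !mx_part_linear.
rewrite !(mulmxDl, mulmxDr) -!(scalemxAl, scalemxAr).
by apply/matrixP => i j; rewrite !mxE; ring.
Qed.

Lemma super_comm_linearr x : linear (super_comm x).
Proof.
move=> a y y'; rewrite /super_comm !big_bool !mx_part_linear.
rewrite !(mulmxDl, mulmxDr) -!(scalemxAl, scalemxAr).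
by apply/matrixP => i j; rewrite !mxE; ring.
Qed.

Lemma trmx_tr0 (B C : 'M[F]_2) : [pchar F] =i pred0 ->
  B^T = B -> C^T = - C -> \tr (B *m C) = 0.
Proof.
move=> F0 hB hC; have : \tr (B *m C) = - \tr (B *m C).
  by rewrite -[LHS]mxtrace_tr trmx_mul hB hC mulNmx linearN /= mxtrace_mulC.
move/eqP; rewrite -addr_eq0 -mulr2n -mulr_natl mulf_eq0 => /orP[|/eqP//].
by rewrite (pcharf0P F).1.
Qed.

Lemma super_comm_homog p q x y : [pchar F] =i pred0 ->
  b2_homog p x -> b2_homog q y -> b2_homog (p (+) q) (super_comm x y).
Proof.
move=> F0 hx hy; rewrite (super_commE hx hy).
case: p hx; case: q hy => /=.
- move=> [B' [C' [hB' hC' ->]]] [B [C [hB hC ->]]].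
  exists (B *m C' + B' *m C).
    by rewrite linearD /= !(trmx_tr0 F0) ?addr0.
  rewrite scaleN1r opprK !mulmx_block !mul0mx !mulmx0 !addr0 !add0r.
  rewrite add_block_mx !addr0 linearD /= !trmx_mul hB hC hB' hC'.
  by rewrite !mulNmx opprD !opprK [C *m B' + _]addrC.
- move=> [A hA ->] [B [C [hB hC ->]]].
  exists (- (B *m A^T) - A *m B), (C *m A + A^T *m C); split.
  + by rewrite linearB linearN /= !trmx_mul trmxK hB addrC.
  + by rewrite linearD /= !trmx_mul trmxK hC mulmxN mulNmx -opprD addrC.
  + rewrite scale1r !mulmx_block !mul0mx !mulmx0 !addr0 !add0r.
    by rewrite opp_block_mx add_block_mx !oppr0 !addr0 !mulmxN !mulNmx !opprK.
- move=> [B [C [hB hC ->]]] [A hA ->].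
  exists (A *m B + B *m A^T), (- (A^T *m C) - C *m A); split.
  + by rewrite linearD /= !trmx_mul trmxK hB addrC.
  + rewrite linearB linearN /= !trmx_mul trmxK hC.
    by rewrite mulmxN mulNmx opprD !opprK addrC.
  + rewrite scale1r !mulmx_block !mul0mx !mulmx0 !addr0 !add0r.
    by rewrite opp_block_mx add_block_mx !oppr0 !addr0 !mulmxN !mulNmx !opprK.
- move=> [A' hA' ->] [A hA ->].
  exists (A *m A' - A' *m A).
    by rewrite linearB /= mxtrace_mulC subrr.
  rewrite scale1r !mulmx_block !mul0mx !mulmx0 !addr0 !add0r.
  rewrite opp_block_mx add_block_mx !oppr0 !addr0 linearB /= !trmx_mul.
  by rewrite !mulmxN !mulNmx !opprK opprB.
Qed.

Hypothesis F0 : [pchar F] =i pred0.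

Lemma b2_br_mem (u v : b2_type) : super_comm (b2_val u) (b2_val v) \in b2_mem.
Proof.
case: u => _ /= /b2_memP[x0 [x1 [h0 h1 ->]]].
case: v => _ /= /b2_memP[y0 [y1 [k0 k1 ->]]].
have lD x y z : super_comm (x + y) z = super_comm x z + super_comm y z.
  by rewrite -[x in LHS]scale1r super_comm_linearl scale1r.
have rD x y z : super_comm z (x + y) = super_comm z x + super_comm z y.
  by rewrite -[x in LHS]scale1r super_comm_linearr scale1r.
have H p q x y : b2_homog p x -> b2_homog q y -> super_comm x y \in b2_mem.
  by move=> hx hy; apply: (b2_homog_mem (super_comm_homog F0 hx hy)).
by rewrite lD !rD; do ?apply: rpredD; [apply: (H false false)
  |apply: (H false true)|apply: (H true false)|apply: (H true true)].
Qed.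

Definition b2_br (u v : b2_type) : b2_type := B2 (b2_br_mem u v).

Definition b2_type_homog (p : bool) : set b2_type :=
  [set u | b2_homog p (b2_val u)].

Lemma b2_type_homog0 p : b2_type_homog p 0.
Proof. exact: (b2_homog0 p). Qed.

Lemma b2_type_homogP p (a : F) u v :
  b2_type_homog p u -> b2_type_homog p v -> b2_type_homog p (a *: u + v).
Proof. exact: b2_homogP. Qed.

Lemma b2_type_homog_sum u : exists u0 u1,
  [/\ b2_type_homog false u0, b2_type_homog true u1 & u = u0 + u1].
Proof.
case: u => x mx; have /b2_memP[x0 [x1 [h0 h1 ex]]] := mx.
exists (B2 (@b2_homog_mem false _ h0)), (B2 (@b2_homog_mem true _ h1)).
by split=> //; apply: val_inj.
Qed.

Lemma b2_type_homog_direct u :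
  b2_type_homog false u -> b2_type_homog true u -> u = 0.
Proof.
move=> h0 h1; apply: val_inj; rewrite /=.
by have := mx_part_homog false h1; rewrite (mx_part_homog false h0).
Qed.

Lemma b2_br_linearl v : linear (b2_br^~ v).
Proof. by move=> a x y; apply: val_inj; apply: super_comm_linearl. Qed.

Lemma b2_br_linearr u : linear (b2_br u).
Proof. by move=> a x y; apply: val_inj; apply: super_comm_linearr. Qed.

Lemma b2_br_homog p q u v : b2_type_homog p u -> b2_type_homog q v ->
  b2_type_homog (p (+) q) (b2_br u v).
Proof. exact: super_comm_homog. Qed.

Lemma b2_br_anti p q u v : b2_type_homog p u -> b2_type_homog q v ->
  b2_br u v + (-1) ^+ (p && q) *: b2_br v u = 0.
Proof.
move=> hu hv; apply: val_inj => /=.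
rewrite (super_commE hu hv) (super_commE hv hu) andbC.
by apply/matrixP => i j; rewrite !mxE; case: (q && p) => /=; ring.
Qed.

Lemma b2_br_jacobi p q u v w : b2_type_homog p u -> b2_type_homog q v ->
  b2_br u (b2_br v w) =
  b2_br (b2_br u v) w + (-1) ^+ (p && q) *: b2_br v (b2_br u w).
Proof.
move=> hu hv; apply: val_inj => /=; move: hu hv; rewrite /b2_type_homog /=.
case: w => _ /= /b2_memP[z0 [z1 [h0 h1 ->]]].
move: (b2_val u) (b2_val v) => x y hx hy.
have rD z z' t : super_comm t (z + z') = super_comm t z + super_comm t z'.
  by rewrite -[z in LHS]scale1r super_comm_linearr scale1r.
suff H r z : b2_homog r z -> super_comm x (super_comm y z) =
    super_comm (super_comm x y) z + (-1) ^+ (p && q) *: super_comm y (super_comm x z).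
  by rewrite !rD (H false) // (H true) // scalerDr addrACA.
move=> hz.
have hyz := super_comm_homog F0 hy hz.
have hxy := super_comm_homog F0 hx hy.
have hxz := super_comm_homog F0 hx hz.
rewrite (super_commE hx hyz) (super_commE hxy hz) (super_commE hy hxz).
rewrite (super_commE hx hy) (super_commE hx hz) (super_commE hy hz).
rewrite !(mulmxBl, mulmxBr) -!(scalemxAl, scalemxAr) !mulmxA.
move: (x *m y *m z) (x *m z *m y) (y *m x *m z) (y *m z *m x) (z *m x *m y)
  (z *m y *m x) => a1 a2 a3 a4 a5 a6.
apply/matrixP => i j; rewrite !mxE.
by case: (p); case: (q); case: (r) => /=; ring.
Qed.

Definition b2 : lieSuperalgebra F :=
  @LieSuperalgebra F b2_type b2_br b2_type_homog b2_type_homog0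
    b2_type_homogP b2_type_homog_sum b2_type_homog_direct b2_br_linearl
    b2_br_linearr b2_br_homog b2_br_anti b2_br_jacobi.

End B2.

(* Main.v *)
Require Import Defs.
From mathcomp Require Import all_boot all_order all_algebra.
From mathcomp Require Import boolp classical_sets reals topology normedtype sequences exp realfun.
From mathcomp Require Import zify ring lra.

(* Write s for sqrt 3 and view b(2) as sl_2 (x) Lambda(xi) + F d/dxi: here
   [b2X t], [b2Y t] and [b2Z] stand for t, xi t and d/dxi, where t is in sl_2.

   Upper bound: multilinear polynomials modulo identities embed into the values at
   basis elements; giving xi t weight 1 and d/dxi weight -1, only the substitutions
   of total weight at most 1 in absolute value matter, and there are at most
   3^k s (2 s)^q of them.

   Lower bound: on sl_2 the operator ad(d/dxi) ad(xi t) is ad t. After choosing which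
   half of the odd variables play the role of d/dxi, a polynomial thus becomes one in
   about k + q/2 variables of sl_2. The alternating sum of
   ad u_1 ad u_2 ad u_3 is 8 det(u_1, u_2, u_3) on sl_2, so each standard tableau
   of shape (r, r, r) gives a product of determinants, one per column. These products
   are independent, because their values on words in e, f, h form a
   triangular matrix, and by the hook formula there are 27^r of them up to a
   polynomial factor.

   Hence, for k > 0, c_{k,q} is 3^k (2 s)^q up to a polynomial factor, and the binomial theorem
   gives c_n = (3 + 2 s)^n up to a polynomial factor. *)

Set Implicit Arguments.
Unset Strict Implicit.
Unset Printing Implicit Defensive.

Import Order.TTheory GRing.Theory Num.Theory numFieldNormedType.Exports.
Local Open Scope classical_set_scope.
Local Open Scope ring_scope.

(** * Bounds on the dimension of a quotient *)

Section QuoDim.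
Variables (F : fieldType) (V : lmodType F) (U W : set V) (d : nat).
Hypotheses (sW : Defs.subspace W) (hd : quo_dim U W d).

(** The coordinates of the [f i] modulo [W] in a basis are linearly independent rows of length
    [d]. *)
Lemma quo_dim_ge (I : finType) (f : I -> V) : (forall i, U (f i)) ->
  (forall c : I -> F, W (\sum_i c i *: f i) -> forall i, c i = 0) ->
  (#|I| <= d)%N.
Proof.
move=> Uf ff; have [b [_ _ gb]] := hd.
have /choice[m mP] : forall i, exists c : 'I_d -> F,
  W (f i - \sum_j c j *: b j) by move=> i; apply: gb.
pose M : 'M[F]_(#|I|, d) := \matrix_(i, j) m (enum_val i) j.
suff /eqP <- : row_free M by apply: rank_leq_col.
rewrite -kermx_eq0; apply/eqP/row_matrixP => r; set c := row r (kermx M).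
have cM : c *m M = 0 by rewrite -row_mul mulmx_ker row0.
rewrite row0; apply/rowP => i; rewrite [RHS]mxE.
rewrite -[i]enum_valK; apply: (ff (fun x => c 0 (enum_rank x))).
have -> : \sum_i c 0 (enum_rank i) *: f i =
    \sum_i c 0 (enum_rank i) *: (f i - \sum_j m i j *: b j).
  under [RHS]eq_bigr do rewrite scalerBr.
  rewrite sumrB [X in _ - X](_ : _ = 0) ?subr0 //.
  under eq_bigr do rewrite scaler_sumr.
  rewrite exchange_big big1 // => j _.
  under eq_bigr do rewrite scalerA.
  rewrite -scaler_suml; have := congr1 (fun X : 'rV_d => X 0 j) cM.
  rewrite !mxE (reindex (@enum_rank I)); last exact/onW_bij/enum_rank_bij.
  under eq_bigr do rewrite [M _ _]mxE enum_rankK.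
  by move=> ->; rewrite scale0r.
case: sW => W0 WP; elim/big_ind: _ => // [x y Wx Wy|x _].
  exact: subspaceD.
exact: subspaceZ.
Qed.

(** If the functionals [phi j] separate [U] modulo [W], the matrix of their values on a basis has
    independent rows. *)
Lemma quo_dim_le (J : finType) (phi : J -> V -> F) :
  Defs.subspace U -> (forall j a u v, phi j (a *: u + v) = a * phi j u + phi j v) ->
  (forall u, U u -> (forall j, phi j u = 0) -> W u) -> (d <= #|J|)%N.
Proof.
move=> sU lphi hW; have [b [Ub fb _]] := hd.
have phi0 j : phi j 0 = 0.
  by have /eqP := lphi j 1 0 0; rewrite scaler0 addr0 mul1r -subr_eq0 opprD addNKr oppr_eq0 => /eqP.
have phi_sum j (c : 'I_d -> F) : phi j (\sum_i c i *: b i) = \sum_i c i * phi j (b i).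
  apply: (big_rec2 (fun x y => phi j x = y)) => // i x y _ <-.
  exact: lphi.
pose M : 'M[F]_(d, #|J|) := \matrix_(i, j) phi (enum_val j) (b i).
suff /eqP <- : row_free M by apply: rank_leq_col.
rewrite -kermx_eq0; apply/eqP/row_matrixP => r; set c := row r (kermx M).
have cM : c *m M = 0 by rewrite -row_mul mulmx_ker row0.
rewrite row0; apply/rowP => i; rewrite [RHS]mxE.
apply: (fb (fun i => c 0 i)); apply: hW; first exact: subspace_lin.
move=> j; rewrite phi_sum.
have := congr1 (fun X : 'rV__ => X 0 (enum_rank j)) cM; rewrite !mxE => /(etrans _); apply.
by apply: eq_bigr => x _; rewrite [M _ _]mxE enum_rankK.
Qed.

End QuoDim.

(** * Evaluation of multilinear polynomials *)

Section Evaluation.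
Variables (F : fieldType) (L : lieSuperalgebra F).
Implicit Types (a : letter -> L) (w : word).

Fixpoint word_eval a w : L :=
  match w with
  | Letter l => a l
  | Prod w1 w2 => lsa_br (word_eval a w1) (word_eval a w2)
  end.

Lemma free_eval_br a f g : graded_subst a ->
  free_eval a (lsa_br f g) = lsa_br (free_eval a f) (free_eval a g).
Proof. by move=> ga; have [_ ->] := free_eval_morphism ga. Qed.

Lemma free_eval_lin a c f g : graded_subst a ->
  free_eval a (c *: f + g) = c *: free_eval a f + free_eval a g.
Proof. by move=> ga; have [->] := free_eval_morphism ga. Qed.

Lemma free_eval0 a : graded_subst a -> free_eval a 0 = 0.
Proof.
by move=> ga; rewrite -[X in free_eval a X](scaler0 _ (-1)) -[X in free_eval a X]addr0
  free_eval_lin // scaleN1r addNr.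
Qed.

Lemma free_eval_sum a (I : finType) (c : I -> F) (f : I -> free_lsa F) :
  graded_subst a ->
  free_eval a (\sum_i c i *: f i) = \sum_i c i *: free_eval a (f i).
Proof.
move=> ga; apply: (big_rec2 (fun x y => free_eval a x = y)) => [|i x y _ <-].
  exact: free_eval0.
exact: free_eval_lin.
Qed.

Lemma free_eval_monomial a w : graded_subst a ->
  free_eval a (monomial F w) = word_eval a w.
Proof.
move=> ga; elim: w => [l|w1 IH1 w2 IH2] /=; first exact: free_eval_gen.
by rewrite free_eval_br // IH1 IH2.
Qed.

Lemma eq_word_eval a a' w : {in letters w, a =1 a'} ->
  word_eval a w = word_eval a' w.
Proof.
elim: w => [l|w1 IH1 w2 IH2] /= h; first by apply: h; rewrite inE.
by rewrite IH1 ?IH2 // => l lw; apply: h; rewrite mem_cat lw ?orbT.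
Qed.

Definition subst_at a l x : letter -> L := fun l' => if l' == l then x else a l'.

(** The letter [l] occurs in exactly one factor of each product, and the bracket is linear in that
    factor. *)
Lemma word_eval_linear a l (c : F) x y w : uniq (letters w) -> l \in letters w ->
  word_eval (subst_at a l (c *: x + y)) w =
  c *: word_eval (subst_at a l x) w + word_eval (subst_at a l y) w.
Proof.
have cst z w' : l \notin letters w' -> word_eval (subst_at a l z) w' = word_eval a w'.
  move=> lw; apply: eq_word_eval => l' lw'; rewrite /subst_at.
  by case: eqP => // e; rewrite e (negPf lw) in lw'.
elim: w => [l'|w1 IH1 w2 IH2] /=.
  by move=> _; rewrite inE => /eqP->; rewrite /subst_at eqxx.
rewrite cat_uniq mem_cat => /and3P[u1 /hasPn dis u2] /orP[l1|l2].
  have l2 : l \notin letters w2 by apply/negP => /dis; rewrite l1.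
  by rewrite IH1 // !(cst _ _ l2) lsa_br_linearl.
by rewrite IH2 // !(cst _ _ (dis _ l2)) lsa_br_linearr.
Qed.

Section Multilinear.
Variables k q : nat.

Lemma multi_letters_uniq : uniq (multi_letters k q).
Proof.
rewrite cat_uniq !map_inj_uniq ?iota_uniq //=; try by move=> i j [].
by rewrite andbT; apply/hasPn => l /mapP[j _ ->]; apply/mapP => [[]].
Qed.

Lemma mem_multi_letters p i :
  ((p, i) \in multi_letters k q) = (i < if p then q else k)%N.
Proof.
have mI (r : bool) (n : nat) : ((p, i) \in [seq (r, j) | j <- iota 0 n]) = (p == r) && (i < n)%N.
  apply/mapP/andP => [[j jn [-> ->]]|[/eqP-> lt]].
    by rewrite eqxx; move: jn; rewrite mem_iota.
  by exists i; rewrite // mem_iota.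
by rewrite mem_cat !mI; case: p {mI}; rewrite //= orbF.
Qed.

Variable f : free_lsa F.
Hypothesis hf : multilinear k q f.

Lemma eq_multilinear_eval a a' : graded_subst a -> graded_subst a' ->
  {in multi_letters k q, a =1 a'} -> free_eval a f = free_eval a' f.
Proof.
case: hf => m [c [u [hu ->]]] ga ga' aa'; rewrite !free_eval_sum //.
apply: eq_bigr => i _; have [w pw ->] := hu i; rewrite !free_eval_monomial //.
by congr (_ *: _); apply: eq_word_eval => l; rewrite (perm_mem pw) => /aa'.
Qed.

Lemma graded_subst_at a l x :
  graded_subst a -> lsa_homog l.1 x -> graded_subst (subst_at a l x).
Proof. by move=> ga hx l'; rewrite /subst_at; case: eqP => [->|]. Qed.

Lemma multilinear_eval_linear a l c x y :
  graded_subst a -> l \in multi_letters k q -> lsa_homog l.1 x -> lsa_homog l.1 y ->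
  free_eval (subst_at a l (c *: x + y)) f =
  c *: free_eval (subst_at a l x) f + free_eval (subst_at a l y) f.
Proof.
case: hf => m [b [u [hu ->]]] ga lkq hx hy.
rewrite !free_eval_sum; try apply: graded_subst_at => //; last exact: lsa_homogP.
rewrite scaler_sumr -big_split; apply: eq_bigr => i _ /=; have [w pw ->] := hu i.
rewrite !free_eval_monomial; try apply: graded_subst_at => //; last exact: lsa_homogP.
rewrite word_eval_linear ?(perm_mem pw) ?(perm_uniq pw) ?multi_letters_uniq //.
by rewrite scalerDr !scalerA mulrC.
Qed.

Lemma multilinear_eval_sum a l (I : finType) (c : I -> F) (x : I -> L) :
  graded_subst a -> l \in multi_letters k q -> (forall i, lsa_homog l.1 (x i)) ->
  free_eval (subst_at a l (\sum_i c i *: x i)) f =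
  \sum_i c i *: free_eval (subst_at a l (x i)) f.
Proof.
move=> ga lkq hx.
pose P (y : L) := lsa_homog l.1 y.
suff [] : P (\sum_i c i *: x i) /\ free_eval (subst_at a l (\sum_i c i *: x i)) f =
  \sum_i c i *: free_eval (subst_at a l (x i)) f by [].
apply: (big_rec2 (fun s t => P s /\ free_eval (subst_at a l s) f = t)).
  have h0 := lsa_homog0 L l.1; split=> //.
  have := @multilinear_eval_linear a l (-1) 0 0 ga lkq h0 h0.
  by rewrite scaler0 addr0 scaleN1r addNr.
move=> i y z _ [hy <-]; split; first exact: lsa_homogP.
exact: multilinear_eval_linear.
Qed.

(** By multilinearity, values in a homogeneous spanning set suffice to test an identity. *)
Lemma multilinear_vanish (B : bool -> set L) :
  (forall p x, B p x -> lsa_homog p x) ->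
  (forall p x, lsa_homog p x -> exists (m : nat) (c : 'I_m -> F) (b : 'I_m -> L),
     (forall i, B p (b i)) /\ x = \sum_i c i *: b i) ->
  (forall a, graded_subst a -> {in multi_letters k q, forall l, B l.1 (a l)} ->
     free_eval a f = 0) ->
  graded_Id L f.
Proof.
move=> homB spanB van a ga.
(* The list [s] holds the letters whose values are still arbitrary; the induction expands them over
   [B] one at a time. *)
suff H (s : seq letter) : forall a, graded_subst a ->
    {in multi_letters k q, forall l, l \notin s -> B l.1 (a l)} -> free_eval a f = 0.
  by apply: (H (multi_letters k q) a ga) => l ->.
elim: s {a ga} => [|l s IH] a ga ha; first by apply: van => // l lkq; apply: ha.
have [lkq|lkq] := boolP (l \in multi_letters k q); last first.
  apply: IH => // l' l'kq l's; apply: ha => //; rewrite inE negb_or l's andbT.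
  by apply: contraNneq lkq => <-.
have [m [c [b [hb al]]]] := spanB _ _ (ga l).
have -> : a = subst_at a l (\sum_i c i *: b i).
  by apply/funext => l'; rewrite /subst_at; case: eqP => // ->.
rewrite multilinear_eval_sum //; last by move=> i; apply: homB.
apply: big1 => i _; rewrite IH ?scaler0 //.
  by apply: graded_subst_at => //; apply: homB.
move=> l' l'kq l's; rewrite /subst_at; case: eqP => [->//|/eqP ll'].
by apply: ha => //; rewrite inE negb_or ll'.
Qed.

End Multilinear.

End Evaluation.

(** * Coordinates, multiplication table and weights of b(2) *)

Section B2Model.
Variable F : fieldType.
Implicit Types s t : F * F * F.

Definition mx2 (a b c d : F) : 'M[F]_2 :=
  \matrix_(i, j) if i == ord0 then (if j == ord0 then a else b)
                 else (if j == ord0 then c else d).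

Lemma mx2P (A B : 'M[F]_2) :
  [/\ A ord0 ord0 = B ord0 ord0, A ord0 ord_max = B ord0 ord_max,
      A ord_max ord0 = B ord_max ord0 & A ord_max ord_max = B ord_max ord_max] ->
  A = B.
Proof.
move=> [h00 h01 h10 h11]; apply/matrixP.
suff I2 (i : 'I_2) : i = ord0 \/ i = ord_max.
  by move=> i j; case: (I2 i) => ->; case: (I2 j) => ->.
by case: i => [[|[|]]] // lt; [left|right]; apply: val_inj.
Qed.

Lemma mx2E (A : 'M[F]_2) :
  A = mx2 (A ord0 ord0) (A ord0 ord_max) (A ord_max ord0) (A ord_max ord_max).
Proof. by apply: mx2P; split; rewrite mxE. Qed.

Lemma mul_mx2 a b c d a' b' c' d' : mx2 a b c d *m mx2 a' b' c' d' =
  mx2 (a * a' + b * c') (a * b' + b * d') (c * a' + d * c') (c * b' + d * d').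
Proof. by apply: mx2P; split; rewrite !mxE !big_ord_recl big_ord0 !mxE /=; ring. Qed.

Lemma add_mx2 a b c d a' b' c' d' : mx2 a b c d + mx2 a' b' c' d' =
  mx2 (a + a') (b + b') (c + c') (d + d').
Proof. by apply: mx2P; split; rewrite !mxE. Qed.

Lemma opp_mx2 a b c d : - mx2 a b c d = mx2 (- a) (- b) (- c) (- d).
Proof. by apply: mx2P; split; rewrite !mxE. Qed.

Lemma scale_mx2 x a b c d : x *: mx2 a b c d = mx2 (x * a) (x * b) (x * c) (x * d).
Proof. by apply: mx2P; split; rewrite !mxE. Qed.

Lemma tr_mx2 a b c d : (mx2 a b c d)^T = mx2 a c b d.
Proof. by apply: mx2P; split; rewrite !mxE. Qed.

Lemma mx2_0 : (0 : 'M[F]_2) = mx2 0 0 0 0.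
Proof. by apply: mx2P; split; rewrite !mxE. Qed.

Lemma trace_mx2 a b c d : \tr (mx2 a b c d) = a + d.
Proof. by rewrite /mxtrace !big_ord_recl big_ord0 !mxE /= addr0. Qed.

(* (a, b, c) stands for [[a, b], [c, -a]] in sl_2. *)
Definition sl_mx s := let: (a, b, c) := s in mx2 a b c (- a).

(* [sl_mx s] times [[0, 1], [-1, 0]]: this identifies sl_2 with the symmetric
   matrices as a module over sl_2. *)
Definition sl_sym s := let: (a, b, c) := s in mx2 (- b) a a c.

Lemma b2X_subproof s : b2_homog false (block_mx (sl_mx s) 0 0 (- (sl_mx s)^T)).
Proof. by exists (sl_mx s) => //; case: s => [[a b] c]; rewrite trace_mx2 subrr. Qed.

Lemma b2Y_subproof s : b2_homog true (block_mx 0 (sl_sym s) 0 0).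
Proof.
by exists (sl_sym s), 0; rewrite trmx0 oppr0; split=> //; case: s => [[a b] c]; rewrite tr_mx2.
Qed.

Lemma b2Z_subproof : b2_homog true (block_mx 0 0 (mx2 0 (-1) 1 0) 0).
Proof. by exists 0, (mx2 0 (-1) 1 0); rewrite trmx0 tr_mx2 opp_mx2 oppr0 opprK. Qed.

Definition b2X s : b2_type F := B2 (b2_homog_mem (b2X_subproof s)).
Definition b2Y s : b2_type F := B2 (b2_homog_mem (b2Y_subproof s)).
Definition b2Z : b2_type F := B2 (b2_homog_mem b2Z_subproof).

Lemma b2_even_X u : b2_homog false (b2_val u) -> exists s, u = b2X s.
Proof.
case: u => x mx /= [A]; rewrite [A]mx2E trace_mx2 => trA ex.
exists (A ord0 ord0, A ord0 ord_max, A ord_max ord0); apply: val_inj => /=.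
by rewrite ex /sl_mx -(addr0_eq trA).
Qed.

Hypothesis F0 : [pchar F] =i pred0.

Lemma two_neq0 : 2 != 0 :> F.
Proof. by rewrite (pcharf0P F).1. Qed.

Lemma b2_odd_YZ u : b2_homog true (b2_val u) -> exists s z, u = b2Y s + z *: b2Z.
Proof.
case: u => x mx /= [B [C [hB hC ex]]].
exists (B ord0 ord_max, - B ord0 ord0, B ord_max ord_max), (C ord_max ord0).
apply: val_inj => /=; rewrite ex scale_block_mx add_block_mx !scaler0 !addr0 add0r.
have hB' : B ord_max ord0 = B ord0 ord_max by rewrite -[in LHS]hB mxE.
(* A skew-symmetric matrix has zero diagonal, as 2 is invertible. *)
have Cd i : C i i = 0.
  have /eqP := congr1 (fun X : 'M_2 => X i i) hC; rewrite !mxE -addr_eq0 -mulr2n -mulr_natl.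
  by rewrite mulf_eq0 (negPf two_neq0) => /eqP.
have hC' : C ord0 ord_max = - C ord_max ord0 by rewrite -[in LHS](trmxK C) hC !mxE.
rewrite {1}[B]mx2E {1}[C]mx2E hB' !Cd hC' scale_mx2 /sl_sym.
by rewrite opprK mulr0 mulr1 mulrN1.
Qed.

(** The commutator of [sl_mx s] and [sl_mx t] in coordinates. *)
Definition sl_br s t :=
  let: (a, b, c) := s in let: (a', b', c') := t in
  (b * c' - b' * c, 2 * (a * b' - a' * b), 2 * (c * a' - c' * a)).

Notation br := (@lsa_br F (b2 F0)).

Lemma br_XX s t : br (b2X s) (b2X t) = b2X (sl_br s t).
Proof.
apply: val_inj => /=; rewrite (super_commE (b2X_subproof s) (b2X_subproof t)) scale1r.
case: s => [[a b] c]; case: t => [[a' b'] c'].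
rewrite !mulmx_block !mul0mx !mulmx0 !addr0 !add0r opp_block_mx add_block_mx !oppr0 !addr0.
rewrite /sl_br /sl_mx !(tr_mx2, opp_mx2, mul_mx2, add_mx2).
by congr block_mx; congr mx2; ring.
Qed.

(** This is the equivariance of [sl_sym]: the odd element xi s brackets with t to xi [s, t]. *)
Lemma br_YX s t : br (b2Y s) (b2X t) = b2Y (sl_br s t).
Proof.
apply: val_inj => /=; rewrite (super_commE (b2Y_subproof s) (b2X_subproof t)) scale1r.
case: s => [[a b] c]; case: t => [[a' b'] c'].
rewrite !mulmx_block !mul0mx !mulmx0 !addr0 !add0r opp_block_mx add_block_mx !oppr0 !addr0.
rewrite /sl_br /sl_mx /sl_sym !(tr_mx2, opp_mx2, mul_mx2, add_mx2).
by congr block_mx; congr mx2; ring.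
Qed.

Lemma br_ZY s : br b2Z (b2Y s) = b2X s.
Proof.
apply: val_inj => /=; rewrite (super_commE b2Z_subproof (b2Y_subproof s)).
case: s => [[a b] c]; rewrite scaleN1r opprK.
rewrite !mulmx_block !mul0mx !mulmx0 !addr0 !add0r add_block_mx !addr0 add0r.
rewrite /sl_mx /sl_sym !(tr_mx2, opp_mx2, mul_mx2, add_mx2).
by congr block_mx; congr mx2; ring.
Qed.

Lemma br_YY s t : br (b2Y s) (b2Y t) = 0.
Proof.
apply: val_inj => /=; rewrite (super_commE (b2Y_subproof s) (b2Y_subproof t)).
by rewrite scaleN1r opprK !mulmx_block !mul0mx !mulmx0 !addr0 add_block_mx !addr0 block_mx0.
Qed.

(** The elements of sl_2 are constant in xi, so d/dxi kills them. *)
Lemma br_ZX s : br b2Z (b2X s) = 0.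
Proof.
apply: val_inj => /=; rewrite (super_commE b2Z_subproof (b2X_subproof s)) scale1r.
case: s => [[a b] c].
rewrite !mulmx_block !mul0mx !mulmx0 !addr0 !add0r opp_block_mx add_block_mx !oppr0 !addr0.
rewrite /sl_mx !(tr_mx2, opp_mx2, mul_mx2, add_mx2) -[RHS]block_mx0 mx2_0.
by congr block_mx; congr mx2; ring.
Qed.



(* The derivation [x |-> D x - x D] of M_4 attached to D = diag(1, 1, 0, 0) acts
   as 0, 1, -1 on the three blocks A, B, C of an element of b(2). *)
Definition b2_weight (n : int) (u : b2_type F) : Prop :=
  let D : 'M[F]_(2 + 2) := block_mx 1%:M 0 0 0 in
  D *m b2_val u - b2_val u *m D = n%:~R *: b2_val u.

(** Commutation with D is a derivation of the matrix product, so weights add on x y and on y x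
    separately. *)
Lemma b2_weight_br m n p q (u v : b2_type F) :
  b2_homog p (b2_val u) -> b2_homog q (b2_val v) ->
  b2_weight m u -> b2_weight n v -> b2_weight (m + n) (br u v).
Proof.
rewrite /b2_weight => hu hv; set D := block_mx 1%:M 0 0 0.
rewrite /= (super_commE hu hv); move: (b2_val u) (b2_val v) => x y hx hy.
have H x' y' m' n' : D *m x' - x' *m D = m'%:~R *: x' -> D *m y' - y' *m D = n'%:~R *: y' ->
  D *m (x' *m y') - (x' *m y') *m D = (m' + n')%:~R *: (x' *m y').
  move=> hx' hy'; rewrite intrD scalerDl.
  rewrite [m'%:~R *: (_ *m _)]scalemxAl [n'%:~R *: (_ *m _)]scalemxAr -hx' -hy'.
  by rewrite mulmxBl mulmxBr !mulmxA addrA subrK.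
have e1 := H _ _ _ _ hx hy; have e2 := H _ _ _ _ hy hx.
rewrite mulmxBr mulmxBl -scalemxAr -scalemxAl scalerBr scalerA mulrC -scalerA.
rewrite -e1 [m + n]addrC -e2 scalerBr.
move: (D *m _) (D *m _) (_ *m D) (_ *m D) => z1 z2 z3 z4.
by apply/matrixP => i j; rewrite !mxE; ring.
Qed.

(** The eigenvalues of commutation with D are 0, 1 and -1, and in characteristic zero [n] differs
    from all of them in [F]. *)
Lemma b2_weight_eq0 n u : (1 < `|n|)%N -> b2_weight n u -> u = 0.
Proof.
move=> n1; rewrite /b2_weight => h; apply: val_inj => /=.
have int_neq0 (z : int) : z != 0 -> z%:~R != 0 :> F.
  case: z => m; rewrite ?NegzE ?mulrNz ?oppr_eq0 => hm.
    by rewrite -[_%:~R]/(m%:R) (pcharf0P F).1.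
  by rewrite -[_%:~R]/(m.+1%:R) (pcharf0P F).1.
move: (b2_val u) h => x; rewrite -[x]submxK.
rewrite !mulmx_block !mul0mx !mulmx0 !mul1mx !mulmx1 !addr0.
rewrite opp_block_mx add_block_mx subrr !subr0 sub0r scale_block_mx.
have scale_eq0 (m : int) (A : 'M[F]_2) : m != 0 -> m%:~R *: A = 0 -> A = 0.
  by move=> /int_neq0 m0 /eqP; rewrite scaler_eq0 (negPf m0) => /eqP.
move=> /eq_block_mx[eul eur edl edr].
have -> : ulsubmx x = 0 by apply: (scale_eq0 n) (esym eul); apply: contraTneq n1 => ->.
have -> : drsubmx x = 0 by apply: (scale_eq0 n) (esym edr); apply: contraTneq n1 => ->.
have -> : ursubmx x = 0.
  apply: (scale_eq0 (n - 1)); first by apply: contraTneq n1 => /subr0_eq ->.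
  by rewrite rmorphB /= scalerBl -eur scale1r subrr.
have -> : dlsubmx x = 0.
  apply: (scale_eq0 (n + 1)); first by apply: contraTneq n1 => /eqP; rewrite addr_eq0 => /eqP->.
  by rewrite rmorphD /= scalerDl -edl scale1r addNr.
exact: block_mx0.
Qed.

Lemma b2_weightX s : b2_weight 0 (b2X s).
Proof.
rewrite /b2_weight /= !mulmx_block !mul0mx !mulmx0 !mul1mx !mulmx1 !addr0 scale0r.
by rewrite opp_block_mx add_block_mx !subrr block_mx0.
Qed.

Lemma b2_weightY s : b2_weight 1 (b2Y s).
Proof.
rewrite /b2_weight /= !mulmx_block !mul0mx !mulmx0 !mul1mx !addr0 scale1r.
by rewrite opp_block_mx add_block_mx !subrr subr0.
Qed.

Lemma b2_weightZ : b2_weight (-1) b2Z.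
Proof.
rewrite /b2_weight /= !mulmx_block !mul0mx !mulmx0 !mulmx1 !addr0 scaleN1r.
by rewrite !opp_block_mx add_block_mx !subrr sub0r !oppr0.
Qed.

End B2Model.

(** * Upper bound for the partial codimensions *)

Section UpperBound.
Variables (F : fieldType) (F0 : [pchar F] =i pred0).
Notation L := (b2 F0).

(* Indices 0, 1, 2 stand for e, f, h, and the others for 0. *)
Definition sl_base (i : nat) : F * F * F := ((i == 2%N)%:R, (i == 0%N)%:R, (i == 1%N)%:R).

Definition b2_base (p : bool) (i : nat) : L :=
  if p then (if i is j.+1 then b2Y (sl_base j) else b2Z F) else b2X (sl_base i).

Lemma b2_base_homog p i : lsa_homog p (b2_base p i).
Proof.
case: p => /=; last exact: (b2X_subproof (sl_base i)).
by case: i => [|i]; [exact: (b2Z_subproof F)|exact: (b2Y_subproof (sl_base i))].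
Qed.

(** The parity [p] is read as 0 or 1: the even part has dimension 3 and the odd part 4. *)
Lemma b2_base_span p (x : L) : lsa_homog p x ->
  exists c : 'I_(3 + p) -> F, x = \sum_i c i *: b2_base p i.
Proof.
have Xlin a b c : b2X (a, b, c) =
    b *: b2X (sl_base 0) + (c *: b2X (sl_base 1) + a *: b2X (sl_base 2)).
  apply: val_inj => /=; rewrite !scale_block_mx !add_block_mx !scaler0 !addr0.
  rewrite !(tr_mx2, opp_mx2, scale_mx2, add_mx2).
  by congr block_mx; congr mx2; ring.
have Ylin a b c : b2Y (a, b, c) =
    b *: b2Y (sl_base 0) + (c *: b2Y (sl_base 1) + a *: b2Y (sl_base 2)).
  apply: val_inj => /=; rewrite !scale_block_mx !add_block_mx !scaler0 !addr0.
  rewrite !(tr_mx2, opp_mx2, scale_mx2, add_mx2).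
  by congr block_mx; congr mx2; ring.
case: p => [/(b2_odd_YZ F0)[[[a b] c] [z ->]]|/b2_even_X[[[a b] c] ->]].
  (* The coordinates follow the order d/dxi, xi e, xi f, xi h of [b2_base]. *)
  exists (fun i => nth 0 [:: z; b; c; a] i).
  by rewrite !big_ord_recl big_ord0 /= addr0 Ylin addrC.
exists (fun i => nth 0 [:: b; c; a] i).
by rewrite !big_ord_recl big_ord0 /= addr0 Xlin.
Qed.

Lemma word_eval_weight (a : letter -> L) (wt : letter -> int) w :
  graded_subst a -> (forall l, b2_weight (wt l) (a l)) ->
  b2_weight (\sum_(l <- letters w) wt l) (word_eval a w).
Proof.
(* Homogeneity is carried through the induction, because weights are known to add only for
   homogeneous factors. *)
move=> ga hwt; suff [] : (exists p, lsa_homog p (word_eval a w)) /\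
  b2_weight (\sum_(l <- letters w) wt l) (word_eval a w) by [].
elim: w => [l|w1 [[p h1] IH1] w2 [[q h2] IH2]] /=.
  by rewrite big_seq1; split=> //; exists l.1; apply: ga.
split; first by exists (p (+) q); exact: lsa_br_homog h1 h2.
rewrite big_cat; exact: b2_weight_br h1 h2 IH1 IH2.
Qed.

Variables k q : nat.

(** Letters out of range get the basis element of index 0, a choice that polynomials in P_{k,q} do
    not see. *)
Definition base_subst (u : {ffun 'I_k -> 'I_3}) (v : {ffun 'I_q -> 'I_4}) (l : letter) : L :=
  b2_base l.1 (if l.1 then oapp (fun i => v i : nat) 0%N (insub l.2)
               else oapp (fun i => u i : nat) 0%N (insub l.2)).

Lemma base_subst_graded u v : graded_subst (base_subst u v).
Proof. by move=> l; apply: b2_base_homog. Qed.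

Definition odd_weight (i : 'I_4) : int := if i == ord0 then -1 else 1.

(** Even letters have weight 0, so all monomials of P_{k,q} take values of the same weight, the sum
    over the odd letters. *)
Lemma base_subst_weight u (v : {ffun 'I_q -> 'I_4}) (f : free_lsa F) : multilinear k q f ->
  (1 < `|(\sum_i odd_weight (v i))%R|)%N -> free_eval (base_subst u v) f = 0.
Proof.
move=> [m [c [g [hg ->]]]] wt1.
rewrite free_eval_sum; last exact: base_subst_graded.
apply: big1 => i _; have [w pw ->] := hg i.
rewrite free_eval_monomial; last exact: base_subst_graded.
pose wt (l : letter) := if l.1 then odd_weight (oapp v ord0 (insub l.2)) else 0.
suff -> : word_eval (base_subst u v) w = 0 by rewrite scaler0.
apply: (b2_weight_eq0 F0 (n := \sum_(l <- letters w) wt l)).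
  rewrite (perm_big _ pw) /multi_letters big_cat !big_map /= big1 // add0r.
  have -> : \sum_(j <- iota 0 q) wt (true, j) = \sum_(i < q) odd_weight (v i).
    rewrite -[q in iota 0 q]subn0 big_mkord.
    by apply: eq_bigr => j _; rewrite /wt /= valK.
  by [].
apply: word_eval_weight; first exact: base_subst_graded.
case=> [[] j]; rewrite /wt /base_subst /=; last exact: b2_weightX.
case: insubP => [x _ _|_] /=; last exact: (b2_weightZ F).
by case: (v x) => [[|y] lty] /=; [exact: (b2_weightZ F)|exact: (b2_weightY (sl_base y))].
Qed.

Definition balanced (v : {ffun 'I_q -> 'I_4}) := (`|(\sum_i odd_weight (v i))%R| <= 1)%N.

(** Unbalanced substitutions vanish by weight, so the matrix entries of the values at balanced ones
    separate polynomials modulo identities; 16 counts the entries. *)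
Lemma partial_codim_le :
  (partial_codim L k q <= 3 ^ k * #|[pred v | balanced v]| * 16)%N.
Proof.
pose J : finType := ({ffun 'I_k -> 'I_3} * {v | balanced v} * ('I_(2 + 2) * 'I_(2 + 2)))%type.
have -> : (3 ^ k * #|[pred v | balanced v]| * 16 = #|J|)%N.
  by rewrite !card_prod card_ffun card_sig !card_ord.
pose phi (j : J) (f : free_lsa F) : F :=
  b2_val (free_eval (base_subst j.1.1 (val j.1.2)) f) j.2.1 j.2.2.
have sI := graded_Id_subspace L; have sU := lspan_subspace
  [set f | exists2 w, perm_eq (letters w) (multi_letters k q) & f = monomial F w].
apply: (quo_dim_le (partial_codimP L k q) (phi := phi) sU).
  by move=> j a u v; rewrite /phi free_eval_lin ?mxE //; apply: base_subst_graded.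
move=> f Uf phif; split=> //.
apply: (multilinear_vanish Uf (B := fun p x => exists i : 'I_(3 + p), x = b2_base p i)).
- by move=> p x [i ->]; apply: b2_base_homog.
- move=> p x /b2_base_span[c ->]; exists (3 + p)%N, c, (b2_base p); split=> // i.
  by exists i.
move=> a ga ha.
have [u hu] : exists u : {ffun 'I_k -> 'I_3}, forall i : 'I_k, a (false, val i) = b2_base false (u i).
  have /choice[u hu] : forall i : 'I_k, exists j : 'I_3, a (false, val i) = b2_base false j.
    by move=> i; apply: (ha (false, val i)); rewrite mem_multi_letters /=; exact: ltn_ord.
  by exists (finfun u) => i; rewrite ffunE.
have [v hv] : exists v : {ffun 'I_q -> 'I_4}, forall i : 'I_q, a (true, val i) = b2_base true (v i).
  have /choice[v hv] : forall i : 'I_q, exists j : 'I_4, a (true, val i) = b2_base true j.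
    by move=> i; apply: (ha (true, val i)); rewrite mem_multi_letters /=; exact: ltn_ord.
  by exists (finfun v) => i; rewrite ffunE.
have gb := base_subst_graded u v.
rewrite (eq_multilinear_eval Uf ga gb); last first.
  case=> [[] i]; rewrite mem_multi_letters /base_subst /= => lt; rewrite insubT /=.
    exact: (hv (Ordinal lt)).
  exact: (hu (Ordinal lt)).
have [bv|nbv] := boolP (balanced v); last first.
  by apply: base_subst_weight => //; rewrite ltnNge.
apply: val_inj; apply/matrixP => i j; rewrite [RHS]mxE.
exact: (phif (u, exist _ v bv, (i, j))).
Qed.

End UpperBound.

(** * Counting balanced substitutions *)

Lemma prodr_exprz (R : unitRingType) (I : finType) (x : R) (n : I -> int) :
  x \is a GRing.unit -> x ^ (\sum_i n i) = \prod_i x ^ n i.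
Proof.
move=> ux; elim/big_rec2: _ => [|i m y _ <-]; first by rewrite expr0z.
by rewrite exprzDr.
Qed.

(* Chernoff bound: each balanced [v] contributes at least [1 / sqrt 3] to
   [\sum_v \prod_i sqrt 3 ^ (- wt (v i)) = (sqrt 3 + 3 / sqrt 3) ^ q]. *)
Lemma card_balanced (R : rcfType) q :
  #|[pred v | @balanced q v]|%:R <= Num.sqrt 3 * (2 * Num.sqrt 3) ^+ q :> R.
Proof.
set s := Num.sqrt 3; have s2 : s ^+ 2 = 3 by rewrite sqr_sqrtr.
have s0 : 0 < s by rewrite sqrtr_gt0.
have s1 : 1 <= s by rewrite -sqrtr1 ler_wsqrtr // ler1n.
have us : s \is a GRing.unit by rewrite unitfE gt_eqF.
have -> : (2 * s) ^+ q = \sum_(v : {ffun 'I_q -> 'I_4}) \prod_i s ^ (- odd_weight (v i)).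
  rewrite -(bigA_distr_bigA (fun i j => s ^ (- odd_weight j))) prodr_const card_ord.
  congr (_ ^+ _); rewrite !big_ord_recl big_ord0 /= /odd_weight /= opprK expr1z.
  by rewrite exprN1; apply: (mulfI (lt0r_neq0 s0)); rewrite !mulrDr divff ?gt_eqF // mulr0; lra.
rewrite mulr_sumr (bigID (@balanced q)) /= -[leLHS]addr0 lerD //; last first.
  by apply: sumr_ge0 => v _; rewrite mulr_ge0 ?ltW // prodr_gt0 // => i _; rewrite exprz_gt0.
rewrite -sum1_card natr_sum ler_sum // => v; rewrite inE /balanced => bv.
rewrite -prodr_exprz // -{1}[s]expr1z -exprzDr // sumrN.
move: (\sum_i _) bv => n bv.
(* Balance gives n <= 1, so s^(1 - n) is a natural power of s >= 1. *)
have : 0 <= 1 - n by lia.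
by case: (1 - n) => // m _; rewrite exprn_ege1.
Qed.

(** * Standard tableaux with three rows *)

Section Tableaux.
Local Open Scope nat_scope.

Definition tableau := (seq nat * seq nat * seq nat)%type.

(* Standard Young tableaux with three rows of lengths [a >= b >= c] and entries
   [0, ..., n.-1], listed according to the row of the largest entry. *)
Fixpoint tableaux (n a b c : nat) : seq tableau :=
  if n is m.+1 then
    (if b < a then [seq (rcons t.1.1 m, t.1.2, t.2) | t <- tableaux m a.-1 b c] else [::]) ++
    (if c < b then [seq (t.1.1, rcons t.1.2 m, t.2) | t <- tableaux m a b.-1 c] else [::]) ++
    (if 0 < c then [seq (t.1.1, t.1.2, rcons t.2 m) | t <- tableaux m a b c.-1] else [::])
  else if [&& a == 0, b == 0 & c == 0] then [:: ([::], [::], [::])] else [::].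

Definition is_tableau (n a b c : nat) (t : tableau) :=
  [/\ [/\ size t.1.1 = a, size t.1.2 = b & size t.2 = c],
      perm_eq (t.1.1 ++ t.1.2 ++ t.2) (iota 0 n),
      forall i, i < b -> nth 0 t.1.1 i < nth 0 t.1.2 i
    & forall i, i < c -> nth 0 t.1.2 i < nth 0 t.2 i].

(** The entry [m] ends its row, and it exceeds all the others, so the column condition holds at the
    new cell. *)
Lemma tableauxP n a b c t : c <= b <= a -> t \in tableaux n a b c -> is_tableau n a b c t.
Proof.
have permS m (s s' : seq nat) : perm_eq s (iota 0 m) ->
    (forall p : pred nat, count p s' = p m + count p s) -> perm_eq s' (iota 0 m.+1).
  move=> /permP ps cs; apply/permP => p.
  by rewrite cs -[m.+1]addn1 iotaD count_cat ps /= addn0 addnC.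
have lt_nth m (s s' : seq nat) i : perm_eq s (iota 0 m) -> {subset s' <= s} ->
    i < size s' -> nth 0 s' i < m.
  move=> ps ss lt; have := ss _ (mem_nth 0 lt).
  by rewrite (perm_mem ps) mem_iota.
elim: n a b c t => [|m IH] a b c t cba /=.
  case: ifP => // /and3P[/eqP-> /eqP-> /eqP->]; rewrite inE => /eqP->.
  by split.
rewrite !mem_cat => /or3P[].
- case: ifP => // ba /mapP[[[R0 R1] R2] ht ->] /=.
  have [|[/= s0 s1 s2] pm c01 c12] := IH _ _ _ _ _ ht; first by lia.
  split=> //=; first by rewrite size_rcons s0 prednK //; lia.
  + by apply: permS pm _ => p; rewrite -cats1 !count_cat /=; lia.
  + by move=> i ib; rewrite nth_rcons s0 (_ : i < a.-1) ?c01 //; lia.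
- case: ifP => // cb /mapP[[[R0 R1] R2] ht ->] /=.
  have [|[/= s0 s1 s2] pm c01 c12] := IH _ _ _ _ _ ht; first by lia.
  split=> //=; first by rewrite size_rcons s1 prednK //; lia.
  + by apply: permS pm _ => p; rewrite -cats1 !count_cat /=; lia.
  + move=> i ib; rewrite nth_rcons s1; case: (ltnP i b.-1) => ib'; first exact: c01.
    have -> : i = b.-1 by lia.
    rewrite eqxx; apply: (lt_nth _ _ _ _ pm); last by lia.
    by move=> x xR; rewrite mem_cat xR.
  + by move=> i ic; rewrite nth_rcons s1 (_ : i < b.-1) ?c12 //; lia.
- case: ifP => // c0 /mapP[[[R0 R1] R2] ht ->] /=.
  have [|[/= s0 s1 s2] pm c01 c12] := IH _ _ _ _ _ ht; first by lia.
  split=> //=; first by rewrite size_rcons s2 prednK.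
  + by apply: permS pm _ => p; rewrite -cats1 !count_cat /=; lia.
  + move=> i ic; rewrite nth_rcons s2; case: (ltnP i c.-1) => ic'; first exact: c12.
    have -> : i = c.-1 by lia.
    rewrite eqxx; apply: (lt_nth _ _ _ _ pm); last by lia.
    by move=> x xR; rewrite !mem_cat xR orbT.
Qed.

(* The hook length formula for the shape [(c + y + x, c + y, c)]. *)
Lemma size_tableaux n c y x : n = 3 * c + 2 * y + x ->
  size (tableaux n (c + y + x) (c + y) c) * ((c + y + x).+2`! * (c + y).+1`! * c`!) =
  n`! * (x.+1 * (x + y).+2 * y.+1).
Proof.
elim: n c y x => [|m IH] c y x.
  by case: c y x => [|c] [|y] [|x].
move=> en; set fa := (_ + x).+2`!; set fb := (_ + y).+1`!; set fc := c`!.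
rewrite [tableaux _ _ _ _]/= !size_cat.
set A := size _; set B := size _; set C := size _.
(* Removing the largest entry changes (c, y, x) into (c, y, x - 1), (c, y - 1, x + 1) or (c - 1, y +
   1, x); the factor x, y or c on the right is 0 when this is impossible. *)
have hA : A * (fa * fb * fc) = (c + y + x).+2 * (m`! * (x * (x + y).+1 * y.+1)).
  rewrite /A /fa; case: x {A B C fa} en => [|x] en.
    by rewrite addn0 ltnn !mul0n !muln0.
  rewrite (_ : _ < _) ?size_map; last by lia.
  have /(_ ltac:(lia)) := IH c y x; rewrite -/fb -/fc !addnS !addSn /= (factS (c + y + x).+2).
  by move: (_ `!) (m `!) (size _) => d f s <-; ring.
have hB : B * (fa * fb * fc) = (c + y).+1 * (m`! * (x.+2 * (x + y).+2 * y)).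
  rewrite /B /fa /fb; case: y {A B C fb fa hA} en => [|y] en.
    by rewrite !addn0 ltnn !mul0n !muln0.
  rewrite (_ : _ < _) ?size_map; last by lia.
  have /(_ ltac:(lia)) := IH c y x.+1.
  rewrite -/fc !addnS !addSn /= (factS (c + y).+1).
  by move: (_ `!) (_.+3`!) (m `!) (size _) => d2 d1 f s <-; ring.
have hC : C * (fa * fb * fc) = c * (m`! * (x.+1 * (x + y).+3 * y.+2)).
  rewrite /C /fa /fb /fc; case: c {A B C fa fb fc hA hB} en => [|c] en.
    by rewrite !mul0n.
  rewrite ltn0Sn size_map /=; have /(_ ltac:(lia)) := IH c y.+1 x.
  rewrite !addnS !addSn /= (factS c).
  by move: (c`!) (_.+2`!) (_.+3`!) (m`!) (size _) => d3 d2 d1 f s <-; ring.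
rewrite (mulnDl A (B + C)) (mulnDl B C) hA hB hC (factS m); move: (m`!) => f; rewrite en; ring.
Qed.

Lemma size_square_tableaux r :
  27 ^ r <= 3 * r.+1 ^ 4 * size (tableaux (3 * r) r r r).
Proof.
have H s : size (tableaux (3 * s) s s s) * (s.+2`! * s.+1`! * s`!) = (3 * s)`! * 2.
  have := @size_tableaux (3 * s) s 0 0.
  by rewrite !addn0 => ->; last by lia.
case: r => [|r]; first by [].
(* For s columns the polynomial is s (s + 1)^2 (s + 2). Its growth ratio (s + 2)(s + 3) / (s (s +
   1)) cancels the denominator in the recursion [e], and 27 s (s + 1) <= 3 (3 s + 1)(3 s + 2)
   remains. *)
suff : 27 ^ r.+1 <= 3 * (r.+1 * r.+2 ^ 2 * r.+3) * size (tableaux (3 * r.+1) r.+1 r.+1 r.+1).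
  by move=> h; apply: leq_trans h _; rewrite leq_mul2r leq_mul2l; apply/orP; right; nia.
elim: r => [|r IH].
  have := H 1; rewrite muln1.
  have -> : (3 `! * 2 = 12) by [].
  have -> : (3 `! * 2 `! * 1 `! = 12) by [].
  by move=> h; rewrite (_ : size _ = 1) //; lia.
have g : (3 * r.+2)`! = (3 * r.+1).+3 * ((3 * r.+1).+2 * ((3 * r.+1).+1 * (3 * r.+1)`!)).
  rewrite (_ : 3 * r.+2 = (3 * r.+1).+3); last by lia.
  by rewrite (factS (3 * r.+1).+2) (factS (3 * r.+1).+1) (factS (3 * r.+1)).
move: (H r.+1) (H r.+2); rewrite g (factS r.+3) (factS r.+2) (factS r.+1) {g H}.
move: (size _) (size _) (r.+1`!) (fact_gt0 r.+1) ((3 * r.+1)`!) IH => N' N d d0 f IH e e'.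
have {e e'} e : N' * (r.+3 * r.+4) = N * (3 * (3 * r + 4) * (3 * r + 5)).
  have : 0 < (r.+3 * r.+2 * d) * (r.+2 * d) * d * r.+2 by rewrite !muln_gt0 d0.
  move=> /eqn_pmul2r D; apply/eqP; rewrite -D; apply/eqP.
  transitivity (N' * (r.+4 * (r.+3 * (r.+2 * d)) * (r.+3 * (r.+2 * d)) * (r.+2 * d))); first by ring.
  rewrite e'; transitivity ((3 * r.+1).+3 * ((3 * r.+1).+2 * (3 * r.+1).+1) * (f * 2)); first by ring.
  by rewrite -e; ring.
rewrite expnS; apply: (@leq_trans (27 * (3 * (r.+1 * r.+2 ^ 2 * r.+3) * N))).
  by rewrite leq_mul2l.
rewrite (_ : 3 * _ * N' = 3 * (r.+2 * r.+3) * (N' * (r.+3 * r.+4))); last by ring.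
rewrite e (_ : 27 * _ = 3 * (r.+2 * r.+3) * N * (27 * (r.+1 * r.+2))); last by ring.
rewrite (_ : 3 * _ * (N * _) = 3 * (r.+2 * r.+3) * N * (3 * (3 * r + 4) * (3 * r + 5))); last by ring.
by rewrite leq_mul2l; apply/orP; right; nia.
Qed.

(** Numbers that are not entries of [t] count as row 2, so that variables outside the tableau will
    be given the value h. *)
Definition row_of (t : tableau) (p : nat) : nat :=
  if p \in t.1.1 then 0 else if p \in t.1.2 then 1 else 2.

Definition row_word n t := [seq row_of t p | p <- iota 0 n].

Lemma row_of_lt3 t p : row_of t p < 3.
Proof. by rewrite /row_of; case: ifP => // _; case: ifP. Qed.

Lemma tableau_mem n a b c t p : is_tableau n a b c t ->
  (p \in t.1.1 ++ t.1.2 ++ t.2) = (p < n).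
Proof. by case=> _ pm _ _; rewrite (perm_mem pm) mem_iota. Qed.

(** The last letter of a row word is the row of the largest entry: it separates the three sublists,
    and induction applies within each. *)
Lemma uniq_row_words n a b c : c <= b <= a ->
  uniq [seq row_word n t | t <- tableaux n a b c].
Proof.
elim: n a b c => [|m IH] a b c cba /=; first by case: ifP.
have rcons_word a' b' c' j (f : tableau -> tableau) : c' <= b' <= a' ->
    (forall t, is_tableau m a' b' c' t -> row_word m.+1 (f t) = rcons (row_word m t) j) ->
    [seq row_word m.+1 t | t <- [seq f t | t <- tableaux m a' b' c']] =
    [seq rcons w j | w <- [seq row_word m t | t <- tableaux m a' b' c']].
  move=> h hf; rewrite -!map_comp; apply/eq_in_map => t /tableauxP ht /=.
  exact/hf/ht.
have wordS t t' j : (forall p, p < m -> row_of t' p = row_of t p) -> row_of t' m = j ->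
    row_word m.+1 t' = rcons (row_word m t) j.
  move=> ht hj; rewrite /row_word -addn1 iotaD map_cat /= hj cats1; congr rcons.
  by apply/eq_in_map => p; rewrite mem_iota => /ht.
have notm a' b' c' t : is_tableau m a' b' c' t -> [/\ m \notin t.1.1 & m \notin t.1.2].
  move=> ht; have := tableau_mem m ht; rewrite ltnn !mem_cat => /negbT.
  by rewrite !negb_or => /and3P[].
rewrite !map_cat.
set A := map _ _; set B := map _ _; set C := map _ _.
have [A' [-> uA]] : exists A', A = [seq rcons w 0 | w <- A'] /\ uniq A'.
  rewrite /A; case: ifP => ba; last by exists [::].
  have h : c <= b <= a.-1 by lia.
  exists [seq row_word m t | t <- tableaux m a.-1 b c]; split; last exact: IH.
  apply: rcons_word => // t ht; apply: wordS => [p pm|].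
    by rewrite /row_of /= mem_rcons inE ltn_eqF.
  by rewrite /row_of /= mem_rcons inE eqxx.
have [B' [-> uB]] : exists B', B = [seq rcons w 1 | w <- B'] /\ uniq B'.
  rewrite /B; case: ifP => cb; last by exists [::].
  have h : c <= b.-1 <= a by lia.
  exists [seq row_word m t | t <- tableaux m a b.-1 c]; split; last exact: IH.
  apply: rcons_word => // t ht; have [m0 m1] := notm _ _ _ _ ht.
  apply: wordS => [p pm|].
    by rewrite /row_of /= mem_rcons inE ltn_eqF.
  by rewrite /row_of /= (negPf m0) mem_rcons inE eqxx.
have [C' [-> uC]] : exists C', C = [seq rcons w 2 | w <- C'] /\ uniq C'.
  rewrite /C; case: ifP => c0; last by exists [::].
  have h : c.-1 <= b <= a by lia.
  exists [seq row_word m t | t <- tableaux m a b c.-1]; split; last exact: IH.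
  apply: rcons_word => // t ht; have [m0 m1] := notm _ _ _ _ ht.
  by apply: wordS => [p pm|]; rewrite /row_of //= (negPf m0) (negPf m1).
have rinj (j : nat) : injective (fun w => rcons w j) by move=> w w' /rcons_inj[].
have disj (j j' : nat) X X' : j != j' ->
    ~~ has [in [seq rcons w j | w <- X]] [seq rcons w j' | w <- X'].
  move=> jj'; apply/hasPn => _ /mapP[w _ ->]; apply/mapP => [[w' _ /rcons_inj[_ e]]].
  by rewrite e eqxx in jj'.
by rewrite !cat_uniq has_cat negb_or !map_inj_uniq ?uA ?uB ?uC ?disj.
Qed.

(** This statistic orders the words in the triangularity argument: it grows as large letters move to
    later positions. *)
Definition word_stat n (f : nat -> nat) := \sum_(p <- iota 0 n) p * f p.

Lemma tableau_sum r t (h : nat -> nat) : is_tableau (3 * r) r r r t ->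
  \sum_(p <- iota 0 (3 * r)) h p =
  \sum_(i < r) (h (nth 0 t.1.1 i) + h (nth 0 t.1.2 i) + h (nth 0 t.2 i)).
Proof.
case: t => [[R0 R1] R2] [/= [s0 s1 s2] pm _ _].
transitivity (\sum_(p <- R0 ++ R1 ++ R2) h p); first by apply: perm_big; rewrite perm_sym.
rewrite !big_cat /= [\sum_(p <- R0) _](big_nth 0) [\sum_(p <- R1) _](big_nth 0).
by rewrite [\sum_(p <- R2) _](big_nth 0) s0 s1 s2 !big_mkord !big_split /= addnA.
Qed.

Lemma row_of_col n a b c t i : is_tableau n a b c t ->
  [/\ i < a -> row_of t (nth 0 t.1.1 i) = 0,
      i < b -> row_of t (nth 0 t.1.2 i) = 1
    & i < c -> row_of t (nth 0 t.2 i) = 2].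
Proof.
case: t => [[R0 R1] R2] [/= [s0 s1 s2] pm _ _].
have : uniq (R0 ++ R1 ++ R2) by rewrite (perm_uniq pm) iota_uniq.
rewrite !cat_uniq => /and3P[_ /hasPn d0 /and3P[_ /hasPn d1 _]].
split=> ir.
- by rewrite /row_of /= mem_nth ?s0.
- have R1i : nth 0 R1 i \in R1 by rewrite mem_nth ?s1.
  by rewrite /row_of /= R1i (negPf (d0 _ _)) // mem_cat R1i.
- have R2i : nth 0 R2 i \in R2 by rewrite mem_nth ?s2.
  by rewrite /row_of /= (negPf (d1 _ R2i)) (negPf (d0 _ _)) // mem_cat R2i orbT.
Qed.

Lemma row_of_out n a b c t p : is_tableau n a b c t -> n <= p -> row_of t p = 2.
Proof.
move=> ht; rewrite leqNgt -(tableau_mem p ht) !mem_cat !negb_or => /and3P[h0 h1 _].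
by rewrite /row_of (negPf h0) (negPf h1).
Qed.

(* By the rearrangement inequality in each column. *)
Lemma word_stat_lt r t (f : nat -> nat) : is_tableau (3 * r) r r r t ->
  (forall p, f p < 3) ->
  (forall i, i < r -> uniq [:: f (nth 0 t.1.1 i); f (nth 0 t.1.2 i); f (nth 0 t.2 i)]) ->
  [seq f p | p <- iota 0 (3 * r)] = row_word (3 * r) t \/
  word_stat (3 * r) f < word_stat (3 * r) (row_of t).
Proof.
move=> ht; have := ht; case: t ht => [[R0 R1] R2] ht [/= [s0 s1 s2] pm c01 c12] f3 fu.
set t := (R0, R1, R2); pose g := row_of t.
have g0 i : i < r -> g (nth 0 R0 i) = 0 by case: (row_of_col i ht).
have g1 i : i < r -> g (nth 0 R1 i) = 1 by case: (row_of_col i ht).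
have g2 i : i < r -> g (nth 0 R2 i) = 2 by case: (row_of_col i ht).
have rear u v w x y z : u < v -> v < w -> x < 3 -> y < 3 -> z < 3 -> uniq [:: x; y; z] ->
    [/\ x = 0, y = 1 & z = 2] \/ u * x + v * y + w * z < v + w * 2.
  by case: x y z => [|[|[|x]]] [|[|[|y]]] [|[|[|z]]] //= uv vw _ _ _ _; first [by left|right; lia].
have col i (ir : i < r) := rear _ _ _ _ _ _ (c01 i ir) (c12 i ir) (f3 _) (f3 _) (f3 _) (fu i ir).
have colg i (ir : i < r) : nth 0 R0 i * g (nth 0 R0 i) + nth 0 R1 i * g (nth 0 R1 i) +
    nth 0 R2 i * g (nth 0 R2 i) = nth 0 R1 i + nth 0 R2 i * 2.
  by rewrite g0 // g1 // g2 // muln0 muln1.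
have [fg|/forallPn[i0 fi0]] := boolP [forall i : 'I_r,
    [&& f (nth 0 R0 i) == 0, f (nth 0 R1 i) == 1 & f (nth 0 R2 i) == 2]].
  left; apply/eq_in_map => p; rewrite -(perm_mem pm) !mem_cat.
  case/or3P => /(nthP 0)[i]; rewrite ?s0 ?s1 ?s2 => ir <-; rewrite -/g.
  + by rewrite g0 //; have /forallP/(_ (Ordinal ir))/and3P[/eqP] := fg.
  + by rewrite g1 //; have /forallP/(_ (Ordinal ir))/and3P[_ /eqP] := fg.
  + by rewrite g2 //; have /forallP/(_ (Ordinal ir))/and3P[_ _ /eqP] := fg.
right; rewrite /word_stat !(tableau_sum _ ht) (bigD1 i0) //= [ltnRHS](bigD1 i0) //= -addSn leq_add //.
  rewrite -/g colg //; case: (col i0 (ltn_ord i0)) => // -[h0 h1 h2].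
  by move: fi0; rewrite h0 h1 h2.
apply: leq_sum => i _; rewrite -/g colg //.
by case: (col i (ltn_ord i)) => [[-> -> ->]|/ltnW //]; rewrite muln0 muln1.
Qed.

End Tableaux.

(** * Polynomials built from inner derivations, and triangular independence *)

Section FreeOperators.
Variable F : fieldType.
Implicit Types (l : letter) (s z : seq letter) (f : free_lsa F).

(** The generalization of [multilinear] to any multiset of letters lets polynomials be built one
    operator at a time. *)
Definition letters_span s : set (free_lsa F) :=
  lspan [set f | exists2 w, perm_eq (letters w) s & f = monomial F w].

Definition free_ads z f := foldr (fun l g => lsa_br (free_gen l) g) f z.

(** Each argument is a block of letters, an even letter or a pair of odd ones, whose product of ads
    is alternated as a single operator. *)
Definition free_alt z1 z2 z3 f : free_lsa F :=
  let A y1 y2 y3 := free_ads y1 (free_ads y2 (free_ads y3 f)) in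
  A z1 z2 z3 + A z2 z3 z1 + A z3 z1 z2 - (A z1 z3 z2 + A z2 z1 z3 + A z3 z2 z1).

Lemma letters_span_perm s s' f : perm_eq s s' -> letters_span s f -> letters_span s' f.
Proof.
move=> ss' [m [c [u [hu ->]]]]; exists m, c, u; split=> // i.
by have [w pw e] := hu i; exists w; rewrite ?(perm_trans pw).
Qed.

Lemma letters_span_ads z s f : letters_span s f -> letters_span (z ++ s) (free_ads z f).
Proof.
move=> hf; elim: z => //= l z [m [c [u [hu ->]]]].
exists m, c, (fun i => lsa_br (free_gen l) (u i)); split=> [i|].
  have [w pw ->] := hu i; exists (Prod (Letter l) w) => //=.
  by rewrite perm_cons.
apply: (big_rec2 (fun x y => lsa_br (free_gen l) x = y)) => [|i x y _ <-].
  exact: lsa_br0r.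
by rewrite lsa_brDr lsa_brZr.
Qed.

Lemma letters_span_alt z1 z2 z3 s f : letters_span s f ->
  letters_span (z1 ++ z2 ++ z3 ++ s) (free_alt z1 z2 z3 f).
Proof.
move=> hf.
have A y1 y2 y3 : perm_eq (y1 ++ y2 ++ y3 ++ s) (z1 ++ z2 ++ z3 ++ s) ->
    letters_span (z1 ++ z2 ++ z3 ++ s) (free_ads y1 (free_ads y2 (free_ads y3 f))).
  by move=> py; apply: letters_span_perm py _; do 3 apply: letters_span_ads.
have sS := lspan_subspace [set f | exists2 w,
  perm_eq (letters w) (z1 ++ z2 ++ z3 ++ s) & f = monomial F w].
apply: (subspaceB sS); do 2 ?apply: (subspaceD sS); apply: A;
  by apply/permP => P; rewrite !count_cat; lia.
Qed.

End FreeOperators.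

Section Triangular.
Variables (F : fieldType) (V : lmodType F) (I : finType).

(** If [j] has maximal [stat] among the indices with non-zero coefficient, only the term [i = j]
    survives in the relation at [j]. *)
Lemma triangular_free (stat : I -> nat) (e : I -> I -> V) (c : I -> F) :
  (forall j, e j j != 0) ->
  (forall i j, i != j -> e i j != 0 -> (stat j < stat i)%N) ->
  (forall j, \sum_i c i *: e i j = 0) -> forall i, c i = 0.
Proof.
move=> ed et ec i0; apply/eqP; apply: contraT => ci0.
have [j cj jmax] := @arg_maxnP _ i0 (fun i => c i != 0) stat ci0.
have /eqP := ec j; rewrite (bigD1 j) //= big1 ?addr0.
  by rewrite scaler_eq0 (negPf cj) (negPf (ed j)).
move=> i ij; have [->|eij] := eqVneq (e i j) 0; first by rewrite scaler0.
have [->|ci] := eqVneq (c i) 0; first by rewrite scale0r.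
by have /= := jmax i ci; rewrite leqNgt et.
Qed.

End Triangular.

(** * Action of these operators on sl_2 *)

Section Ads.
Variables (F : fieldType) (L : lieSuperalgebra F).

Definition ads (a : letter -> L) z (u : L) := foldr (fun l v => lsa_br (a l) v) u z.

Lemma free_eval_ads a z f : graded_subst a -> free_eval a (free_ads z f) = ads a z (free_eval a f).
Proof. by move=> ga; elim: z => //= l z <-; rewrite free_eval_br // free_eval_gen. Qed.

Lemma ads_scale a z c u : ads a z (c *: u) = c *: ads a z u.
Proof. by elim: z => //= l z ->; rewrite lsa_brZr. Qed.

End Ads.

Section Operators.
Variables (F : fieldType) (F0 : [pchar F] =i pred0).
Notation L := (b2 F0).
Implicit Types (s t : F * F * F).

Definition sl_det s1 s2 s3 : F :=
  let: (a1, b1, c1) := s1 in let: (a2, b2, c2) := s2 in let: (a3, b3, c3) := s3 in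
  a1 * (b2 * c3 - c2 * b3) - b1 * (a2 * c3 - c2 * a3) + c1 * (a2 * b3 - b2 * a3).

(* [e [f, h] + f [h, e] + h [e, f]] is the Casimir element [h^2 + 2 (e f + f e)],
   which acts by 8 on the adjoint representation. *)
Lemma sl_alt s1 s2 s3 t : 
  let A s1 s2 s3 := b2X (sl_br s1 (sl_br s2 (sl_br s3 t))) in
  A s1 s2 s3 + A s2 s3 s1 + A s3 s1 s2 - (A s1 s3 s2 + A s2 s1 s3 + A s3 s2 s1) =
  (8 * sl_det s1 s2 s3) *: b2X t.
Proof.
apply: val_inj; move: s1 s2 s3 t => [[a1 b1] c1] [[a2 b2] c2] [[a3 b3] c3] [[a b] c] /=.
rewrite !scale_block_mx !add_block_mx !opp_block_mx !add_block_mx !scaler0 !addr0 !subrr.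
rewrite !(tr_mx2, opp_mx2, scale_mx2, add_mx2).
by congr block_mx; congr mx2; ring.
Qed.

Lemma sl_det_base x y z : (x < 3)%N -> (y < 3)%N -> (z < 3)%N ->
  (sl_det (sl_base F x) (sl_base F y) (sl_base F z) != 0) = uniq [:: x; y; z].
Proof.
case: x y z => [|[|[|x]]] [|[|[|y]]] [|[|[|z]]] // _ _ _; rewrite /sl_det /sl_base /=;
by rewrite !(mul0r, mulr0, mul1r, mulr1, subr0, sub0r, addr0, add0r, oppr0, opprK, subrr, addNr)
  ?oppr_eq0 ?oner_eq0 ?eqxx.
Qed.

Lemma b2X0 : b2X (0, 0, 0) = 0 :> L.
Proof. by apply: val_inj; rewrite /= tr_mx2 !oppr0 -mx2_0 oppr0 block_mx0. Qed.

Lemma b2X_eq0 t : b2X t = 0 :> L -> t = (0, 0, 0).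
Proof.
case: t => [[a b] c] /(congr1 (fun u : L => ulsubmx (b2_val u))) /=.
rewrite block_mxKul => /matrixP h.
have := h ord0 ord0; have := h ord0 ord_max; have := h ord_max ord0.
by rewrite !mxE /= => -> -> ->.
Qed.

Section Evaluation.
Variables (a : letter -> L) (ga : graded_subst a).
Variables (vv : nat -> seq letter) (tau : nat -> F * F * F) (m : nat).
Hypothesis vv_ads : forall i t, (i < m)%N -> ads a (vv i) (b2X t) = b2X (sl_br (tau i) t).

(** Only the action of each block as some ad ([tau i]) on the even part enters, so this serves
    matching and mismatched substitutions alike. *)
Lemma free_eval_alt i1 i2 i3 f c t : (i1 < m)%N -> (i2 < m)%N -> (i3 < m)%N ->
  free_eval a f = c *: b2X t ->
  free_eval a (free_alt (vv i1) (vv i2) (vv i3) f) =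
  (8 * sl_det (tau i1) (tau i2) (tau i3) * c) *: b2X t.
Proof.
move=> h1 h2 h3 ef.
have A j1 j2 j3 : (j1 < m)%N -> (j2 < m)%N -> (j3 < m)%N ->
    free_eval a (free_ads (vv j1) (free_ads (vv j2) (free_ads (vv j3) f))) =
    c *: b2X (sl_br (tau j1) (sl_br (tau j2) (sl_br (tau j3) t))).
  by move=> k1 k2 k3; rewrite !free_eval_ads // ef !ads_scale !vv_ads.
have fD f1 f2 : free_eval a (f1 + f2) = free_eval a f1 + free_eval a f2.
  by rewrite -[f1]scale1r free_eval_lin // !scale1r.
have fN f1 : free_eval a (- f1) = - free_eval a f1.
  by rewrite -scaleN1r -[_ *: _]addr0 free_eval_lin // free_eval0 // addr0 scaleN1r.
rewrite /free_alt fD fN !fD !A // -!scalerDr -scalerBr sl_alt scalerA.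
by rewrite [c * _]mulrC.
Qed.

Lemma free_eval_alts r (t : tableau) f c s : is_tableau (3 * r) r r r t -> (3 * r <= m)%N ->
  free_eval a f = c *: b2X s ->
  free_eval a (foldr (fun i => free_alt (vv (nth 0%N t.1.1 i)) (vv (nth 0%N t.1.2 i))
                       (vv (nth 0%N t.2 i))) f (iota 0 r)) =
  ((\prod_(i < r) (8 * sl_det (tau (nth 0%N t.1.1 i)) (tau (nth 0%N t.1.2 i))
                    (tau (nth 0%N t.2 i)))) * c) *: b2X s.
Proof.
move=> ht rm ef.
have lt_m x : x \in t.1.1 ++ t.1.2 ++ t.2 -> (x < m)%N.
  by rewrite (tableau_mem _ ht) => /leq_trans; apply.
have [[s0 s1 s2] _ _ _] := ht.
rewrite -(big_mkord xpredT (fun i => 8 * sl_det (tau (nth 0%N t.1.1 i))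
  (tau (nth 0%N t.1.2 i)) (tau (nth 0%N t.2 i)))) /index_iota subn0.
have : {subset iota 0 r <= [pred i | i < r]%N} by move=> i; rewrite mem_iota.
elim: (iota 0 r) => [|i q IH] ir /=; first by rewrite big_nil mul1r.
rewrite big_cons -mulrA; have lir : (i < r)%N by apply: ir; rewrite inE eqxx.
apply: free_eval_alt; try by apply: lt_m; rewrite !mem_cat mem_nth ?s0 ?s1 ?s2 ?orbT.
by apply: IH => j jq; apply: ir; rewrite inE jq orbT.
Qed.

Lemma free_eval_pads f t j k : (j + k <= m)%N -> free_eval a f = b2X t ->
  free_eval a (foldr (fun i => free_ads (vv i)) f (iota j k)) =
  b2X (foldr (fun i => sl_br (tau i)) t (iota j k)).
Proof.
move=> jk ef; have : {subset iota j k <= [pred i | i < m]%N}.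
  by move=> i; rewrite mem_iota inE => /andP[_ /leq_trans]; apply.
elim: (iota j k) => [|i q IH] im //=.
rewrite free_eval_ads // IH ?vv_ads //; first by apply: im; rewrite inE eqxx.
by move=> x xq; apply: im; rewrite inE xq orbT.
Qed.

End Evaluation.

End Operators.

(** * Lower bound for the partial codimensions *)

Section LowerBound.
Variables (F : fieldType) (F0 : [pchar F] =i pred0) (k q : nat).
Notation L := (b2 F0).
Implicit Types (S : {set 'I_q}) (t : tableau).

Definition odd_letters S : seq letter := [seq (true, val i) | i <- enum S].

Lemma mem_odd_letters S (i : 'I_q) : ((true, val i) \in odd_letters S) = (i \in S).
Proof. by rewrite mem_map ?mem_enum // => x y [/val_inj]. Qed.

Lemma odd_letters_uniq S : uniq (odd_letters S).
Proof. by rewrite map_inj_uniq ?enum_uniq // => x y [/val_inj]. Qed.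

Lemma size_odd_letters S : size (odd_letters S) = #|S|.
Proof. by rewrite size_map -cardE. Qed.

Lemma odd_letters_notin S l : l \in odd_letters (~: S) -> l \notin odd_letters S.
Proof. by case/mapP => i; rewrite mem_enum inE => iS ->; rewrite mem_odd_letters. Qed.

(* [ad y_r ad y_s] acts on the even part as an even variable when [y_r] is
   specialized to [b2Z] and [y_s] to some [b2Y s]. *)
Definition odd_pairs S := zip (odd_letters (~: S)) (odd_letters S).

(** The even letter of index 0 is left out: it is the vector on which the virtual variables act. *)
Definition virtual_letters S : seq (seq letter) :=
  [seq [:: (false, i)] | i <- iota 1 k] ++ [seq [:: p.1; p.2] | p <- odd_pairs S].

Definition virtual S (i : nat) := nth [::] (virtual_letters S) i.

(** Of the [m] virtual variables, [3 * r] fill the tableau; the at most two others serve as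
    padding. *)
Let m := (k + q./2)%N.
Let r := (m %/ 3)%N.

(** From the inside out: the first even letter, the padding, one alternation per column of [t], and
    the odd letter left unpaired when [q] is odd. *)
Definition tableau_poly S t : free_lsa F :=
  free_ads (drop q./2 (odd_letters S))
    (foldr (fun i => free_alt (virtual S (nth 0%N t.1.1 i)) (virtual S (nth 0%N t.1.2 i))
                       (virtual S (nth 0%N t.2 i)))
       (foldr (fun i => free_ads (virtual S i)) (free_gen (false, 0%N)) (iota (3 * r) (m - 3 * r)))
       (iota 0 r)).

(** Position [p] receives the basis element of sl_2 indexed by the row of [p]: position [i] belongs
    to the even letter [i.+1], position [k + j] to the letter of index [j] in [S], where it is
    multiplied by xi. Odd letters outside [S] become d/dxi. *)
Definition tableau_subst S t (l : letter) : L :=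
  if l.1 then
    if l \in odd_letters S then b2_base F0 true (row_of t (k + index l (odd_letters S))).+1
    else b2_base F0 true 0
  else if l.2 is i.+1 then b2_base F0 false (row_of t i) else b2_base F0 false 0.

Lemma tableau_subst_graded S t : graded_subst (tableau_subst S t).
Proof.
case=> [[] i]; rewrite /tableau_subst [_.1]/= [_.2]/=.
  by case: ifP => _; apply: (b2_base_homog F0 true).
by case: i => [|i]; apply: (b2_base_homog F0 false).
Qed.

Section HalfSet.
Variable S : {set 'I_q}.
Hypothesis cardS : #|S| = uphalf q.

Let cardC : #|~: S| = q./2.
Proof. by have := cardsC S; rewrite cardS card_ord uphalf_half; have := odd_double_half q; lia. Qed.

Lemma size_odd_pairs : size (odd_pairs S) = q./2.
Proof. by rewrite size_zip !size_odd_letters cardS cardC uphalf_half; lia. Qed.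

Lemma size_virtual_letters : size (virtual_letters S) = m.
Proof. by rewrite size_cat !size_map size_iota size_odd_pairs. Qed.

Lemma odd_lettersE : odd_letters S = unzip2 (odd_pairs S) ++ drop q./2 (odd_letters S).
Proof.
rewrite -{1}[odd_letters S](cat_take_drop q./2); congr (_ ++ _).
rewrite /odd_pairs -{2}[odd_letters S](cat_take_drop q./2).
have szt : size (take q./2 (odd_letters S)) = size (odd_letters (~: S)).
  by rewrite size_takel !size_odd_letters ?cardC // cardS uphalf_half leq_addl.
have zip0 (s : seq letter) : zip ([::] : seq letter) s = [::] by case: s.
by rewrite -[odd_letters (~: S)]cats0 zip_cat // [zip [::] _]zip0 cats0 unzip2_zip // szt.
Qed.

(** The entries of [t] run once through the virtual variables below [3 * r] and the padding through
    the rest, so each letter is used once. *)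
Lemma tableau_poly_multilinear t : is_tableau (3 * r) r r r t ->
  multilinear k.+1 q (tableau_poly S t).
Proof.
move=> ht; apply: (@letters_span_perm _ (drop q./2 (odd_letters S) ++
  flatten [seq virtual S (nth 0%N t.1.1 i) ++ virtual S (nth 0%N t.1.2 i) ++
               virtual S (nth 0%N t.2 i) | i <- iota 0 r] ++
  flatten [seq virtual S i | i <- iota (3 * r) (m - 3 * r)] ++ [:: (false, 0%N)])).
- apply/permP => P; pose h i := count P (virtual S i).
  have H s : count P (flatten [seq virtual S i | i <- s]) = (\sum_(i <- s) h i)%N.
    by rewrite count_flatten -map_comp sumnE big_map.
  have H3 : count P (flatten [seq virtual S (nth 0%N t.1.1 i) ++ virtual S (nth 0%N t.1.2 i) ++
               virtual S (nth 0%N t.2 i) | i <- iota 0 r]) = (\sum_(i <- iota 0 (3 * r)) h i)%N.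
    rewrite (tableau_sum _ ht) count_flatten -map_comp sumnE big_map.
    rewrite -[in RHS](big_mkord xpredT (fun i =>
      (h (nth 0 t.1.1 i) + h (nth 0 t.1.2 i) + h (nth 0 t.2 i)))%N).
    by rewrite /index_iota subn0; apply: eq_bigr => i _ /=; rewrite !count_cat addnA.
  have -> : count P (multi_letters k.+1 q) =
      (P (false, 0%N) + count P [seq (false, i) | i <- iota 1 k] +
       (count P (odd_letters S) + count P (odd_letters (~: S))))%N.
    rewrite /multi_letters /= count_cat addnA; congr (_ + _)%N.
    rewrite -count_cat; apply/permP; apply: uniq_perm.
    + by rewrite map_inj_uniq ?iota_uniq // => x y [].
    + rewrite cat_uniq !odd_letters_uniq andbT /=; apply/hasPn => l; exact: odd_letters_notin.
    + move=> l; rewrite mem_cat; apply/mapP/orP => [[i]|[]/mapP[i _ ->]].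
      * rewrite mem_iota => iq ->; have := mem_odd_letters S (Ordinal (iq : i < q)%N).
        have := mem_odd_letters (~: S) (Ordinal (iq : i < q)%N); rewrite inE /= => -> ->.
        by case: (_ \in S); [left|right].
      * by exists (val i); rewrite // mem_iota /= add0n.
      * by exists (val i); rewrite // mem_iota /= add0n.
  rewrite !count_cat H3 H [count P [:: _]]/= addn0.
  have := congr1 (count P) odd_lettersE; rewrite count_cat => oE.
  have -> : count P (odd_letters (~: S)) = count P (unzip1 (odd_pairs S)).
    rewrite unzip1_zip // !size_odd_letters cardC cardS uphalf_half; exact: leq_addl.
  have E : (\sum_(i <- iota 0 (3 * r)) h i + \sum_(i <- iota (3 * r) (m - 3 * r)) h i =
     count P [seq (false, i) | i <- iota 1 k] +
     (count P (unzip1 (odd_pairs S)) + count P (unzip2 (odd_pairs S))))%N.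
    rewrite -big_cat -[X in iota X (m - _)]add0n -iotaD subnKC; last first.
      by rewrite mulnC leq_trunc_div.
    rewrite -size_virtual_letters -H map_nth_iota0 // take_size /virtual_letters.
    rewrite flatten_cat count_cat; congr (_ + _)%N.
      by elim: (iota 1 k) => //= i s ->.
    by elim: (odd_pairs S) => //= p s ->; lia.
  by move: E oE; lia.
- apply: letters_span_ads.
  elim: (iota 0 r) => [|i s IH] /=.
    elim: (iota (3 * r) _) => [|i s IH] /=.
      exists 1%N, (fun=> 1), (fun=> free_gen (false, 0%N)); split=> [_|].
        by exists (Letter (false, 0%N)).
      by rewrite big_ord1 scale1r.
    by rewrite -catA; apply: letters_span_ads.
  by rewrite -!catA; apply: letters_span_alt.
Qed.

End HalfSet.

Lemma virtual_ads_eq S t i s : #|S| = uphalf q -> (i < m)%N ->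
  ads (tableau_subst S t) (virtual S i) (b2X s) = b2X (sl_br (sl_base F (row_of t i)) s).
Proof.
move=> cS im; rewrite /virtual /virtual_letters nth_cat size_map size_iota.
case: ltnP => ik.
  by rewrite (nth_map 0%N) ?size_iota // nth_iota //= /tableau_subst /=; exact: br_XX.
have iq : (i - k < size (odd_pairs S))%N by rewrite size_odd_pairs //; lia.
have [iS iC] : (i - k < size (odd_letters S))%N /\ (i - k < size (odd_letters (~: S)))%N.
  by move: iq; rewrite size_zip leq_min => /andP[].
rewrite (nth_map ((true, 0%N), (true, 0%N))) // nth_zip_cond iq [_.1]/= [_.2]/=.
set lr := nth _ (odd_letters (~: S)) _; set ls := nth _ _ _.
rewrite -[ads _ _ _]/(lsa_br (tableau_subst S t lr) (lsa_br (tableau_subst S t ls) (b2X s))).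
have lrS : lr \notin odd_letters S by apply/odd_letters_notin/mem_nth.
have odd1 S'' l : l \in odd_letters S'' -> l.1 by case/mapP => x _ ->.
have lr1 : lr.1 by apply: (odd1 (~: S)); apply: mem_nth.
have ls1 : ls.1 by apply: (odd1 S); apply: mem_nth.
rewrite /tableau_subst lr1 ls1 (negPf lrS) mem_nth // index_uniq ?odd_letters_uniq //.
by rewrite subnKC // [b2_base _ _ 0]/= [b2_base _ _ _]/= br_YX br_ZY.
Qed.

(** A pair whose roles differ for [S'] acts on sl_2 as zero: either its inner letter is d/dxi, which
    kills sl_2, or both letters are multiples of xi, and xi^2 = 0. *)
Lemma virtual_ads_neq S S' t : #|S| = uphalf q -> #|S'| = uphalf q -> S != S' ->
  exists tau : nat -> F * F * F,
    (forall i s, (i < m)%N ->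
       ads (tableau_subst S' t) (virtual S i) (b2X s) = b2X (sl_br (tau i) s)) /\
    exists2 i, (i < m)%N & tau i = (0, 0, 0).
Proof.
move=> cS cS' SS'.
have br0 s : sl_br (0, 0, 0) s = (0, 0, 0).
  by case: s => [[a b] c]; rewrite /sl_br !mul0r !mulr0 !subr0 mulr0.
pose l0 : letter := (true, 0%N).
pose lr i := nth l0 (odd_letters (~: S)) (i - k).
pose ls i := nth l0 (odd_letters S) (i - k).
pose tau i := if (i < k)%N then sl_base F (row_of t i) else
  if (lr i \notin odd_letters S') && (ls i \in odd_letters S')
  then sl_base F (row_of t (k + index (ls i) (odd_letters S'))) else (0, 0, 0).
have mk : m = (k + #|~: S|)%N.
  by have := cardsC S; rewrite cS card_ord uphalf_half /m; have := odd_double_half q; lia.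
exists tau; split=> [i s im|].
  rewrite /virtual /virtual_letters nth_cat size_map size_iota /tau.
  case: ltnP => ik.
    by rewrite (nth_map 0%N) ?size_iota // nth_iota //= /tableau_subst /=; exact: br_XX.
  have iq : (i - k < size (odd_pairs S))%N by rewrite size_odd_pairs //; move: im; rewrite /m; lia.
  have [iC iS] : (i - k < size (odd_letters (~: S)))%N /\ (i - k < size (odd_letters S))%N.
    by move: iq; rewrite size_zip leq_min => /andP[].
  rewrite (nth_map (l0, l0)) // nth_zip_cond iq [_.1]/= [_.2]/= -/(lr i) -/(ls i).
  rewrite -[ads _ _ _]/(lsa_br (tableau_subst S' t (lr i))
    (lsa_br (tableau_subst S' t (ls i)) (b2X s))).
  have odd1 S'' l : l \in odd_letters S'' -> l.1 by case/mapP => x _ ->.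
  have lr1 : (lr i).1 by apply: (odd1 (~: S)); apply: mem_nth.
  have ls1 : (ls i).1 by apply: (odd1 S); apply: mem_nth.
  rewrite /tableau_subst lr1 ls1 [b2_base _ _ 0]/=.
  have YE x : b2_base F0 true x.+1 = b2Y (sl_base F x) by [].
  rewrite !YE.
  case: (ls i \in odd_letters S'); rewrite ?andbF ?andbT; last first.
    by rewrite br0 b2X0 br_ZX; case: ifP => _; apply: lsa_br0r.
  case: (lr i \in odd_letters S'); first by rewrite br0 b2X0 br_YX br_YY.
  by rewrite br_YX br_ZY.
(* The sets have the same size, so some [j] of [S'] lies outside [S]. The whole complement of [S] is
   paired, so [j] is the outer letter of a pair, now with a value in xi sl_2. *)
have /subsetPn[j jS' jS] : ~~ (S' \subset S).
  by apply: contraNN SS' => SS'; rewrite eq_sym eqEcard SS' cS cS' /=.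
have jC : (true, val j) \in odd_letters (~: S) by rewrite mem_odd_letters inE.
exists (k + index (true, val j) (odd_letters (~: S)))%N.
  by rewrite mk ltn_add2l -size_odd_letters index_mem.
by rewrite /tau ltnNge leq_addr /= /lr addKn nth_index // mem_odd_letters jS'.
Qed.


Lemma tableau_poly_eval (a : letter -> L) (tau : nat -> F * F * F) S t :
  graded_subst a -> a (false, 0%N) = b2X (sl_base F 0) ->
  (forall i s, (i < m)%N -> ads a (virtual S i) (b2X s) = b2X (sl_br (tau i) s)) ->
  is_tableau (3 * r) r r r t ->
  free_eval a (tableau_poly S t) =
  (\prod_(i < r) (8 * sl_det (tau (nth 0%N t.1.1 i)) (tau (nth 0%N t.1.2 i))
                   (tau (nth 0%N t.2 i)))) *:
  ads a (drop q./2 (odd_letters S))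
    (b2X (foldr (fun i => sl_br (tau i)) (sl_base F 0) (iota (3 * r) (m - 3 * r)))).
Proof.
move=> ga a0 htau ht; have rm : (3 * r <= m)%N by rewrite mulnC leq_trunc_div.
rewrite free_eval_ads // -ads_scale; congr ads.
have e0 : free_eval a (free_gen (false, 0%N)) = b2X (sl_base F 0) by rewrite free_eval_gen.
have jm : (3 * r + (m - 3 * r) <= m)%N by rewrite subnKC.
have e1 := free_eval_pads ga htau jm e0; rewrite -[RHS]scale1r in e1.
by rewrite (free_eval_alts ga htau ht rm e1) mulr1.
Qed.

(** Some virtual variable acts as zero: in the tableau it gives a determinant with a zero row, in
    the padding it kills the vector. *)
Lemma tableau_poly_eval_neq S S' t t' : #|S| = uphalf q -> #|S'| = uphalf q -> S != S' ->
  is_tableau (3 * r) r r r t -> free_eval (tableau_subst S' t') (tableau_poly S t) = 0.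
Proof.
move=> cS cS' SS' ht; have [tau [htau [i0 i0m tau0]]] := virtual_ads_neq t' cS cS' SS'.
rewrite (tableau_poly_eval _ _ htau ht) //; last exact: tableau_subst_graded.
have [i0r|ri0] := ltnP i0 (3 * r).
  suff -> : \prod_(i < r) (8 * sl_det (tau (nth 0%N t.1.1 i)) (tau (nth 0%N t.1.2 i))
                   (tau (nth 0%N t.2 i))) = 0 by rewrite scale0r.
  have [[s0 s1 s2] _ _ _] := ht.
  have d1 s s' : sl_det (0, 0, 0) s s' = 0.
    by case: s => [[a b] c]; case: s' => [[a' b'] c']; rewrite /sl_det; ring.
  have d2 s s' : sl_det s (0, 0, 0) s' = 0.
    by case: s => [[a b] c]; case: s' => [[a' b'] c']; rewrite /sl_det; ring.
  have d3 s s' : sl_det s s' (0, 0, 0) = 0.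
    by case: s => [[a b] c]; case: s' => [[a' b'] c']; rewrite /sl_det; ring.
  move: i0r; rewrite -(tableau_mem _ ht) !mem_cat.
  case/or3P => /(nthP 0%N)[i]; rewrite ?s0 ?s1 ?s2 => ir ei;
    rewrite (bigD1 (Ordinal ir)) //= ei tau0.
  - by rewrite d1 mulr0 mul0r.
  - by rewrite d2 mulr0 mul0r.
  - by rewrite d3 mulr0 mul0r.
have br0 s : sl_br (0, 0, 0) s = (0, 0, 0).
  by case: s => [[a b] c]; rewrite /sl_br !mul0r !mulr0 !subr0 mulr0.
have br0' s : sl_br s (0, 0, 0) = (0, 0, 0).
  by case: s => [[a b] c]; rewrite /sl_br !mul0r !mulr0 !subr0 mulr0.
have -> : foldr (fun i => sl_br (tau i)) (sl_base F 0) (iota (3 * r) (m - 3 * r)) = (0, 0, 0).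
  have : i0 \in iota (3 * r) (m - 3 * r) by rewrite mem_iota ri0 subnKC // mulnC leq_trunc_div.
  elim: (iota _ _) => //= i s IH; rewrite inE => /orP[/eqP <-|/IH ->]; last by rewrite br0'.
  by rewrite tau0 br0.
by rewrite b2X0 -[X in ads _ _ X](scale0r 0) ads_scale scale0r scaler0.
Qed.

Lemma tableau_poly_eval_diag S t : #|S| = uphalf q ->
  is_tableau (3 * r) r r r t -> free_eval (tableau_subst S t) (tableau_poly S t) != 0.
Proof.
move=> cS ht.
rewrite (tableau_poly_eval (tau := fun i => sl_base F (row_of t i)) _ _ _ ht) //; first last.
- by move=> i s im; apply: virtual_ads_eq.
- exact: tableau_subst_graded.
have neq0 n : n.+1%:R != 0 :> F by rewrite (pcharf0P F).1.
(* Padding variables take the value h, and ad h multiplies e by 2. *)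
have -> : foldr (fun i => sl_br (sl_base F (row_of t i))) (sl_base F 0)
    (iota (3 * r) (m - 3 * r)) = (0, 2 ^+ (m - 3 * r), 0).
  have : {subset iota (3 * r) (m - 3 * r) <= [pred i | 3 * r <= i]%N}.
    by move=> i; rewrite mem_iota => /andP[].
  rewrite -[X in 2 ^+ X](size_iota (3 * r)).
  elim: (iota _ _) => [|i s IH] hs //=; rewrite IH; last first.
    by move=> x xs; apply: hs; rewrite inE xs orbT.
  rewrite (row_of_out ht); last by apply: hs; rewrite inE eqxx.
  by rewrite /sl_br /sl_base /= exprS; congr (_, _, _); ring.
rewrite scaler_eq0 negb_or; apply/andP; split.
  apply/prodf_neq0 => i _; rewrite mulf_neq0 ?neq0 //.
  have [h0 h1 h2] := row_of_col i ht.
  by rewrite sl_det_base ?row_of_lt3 // h0 // h1 // h2.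
set x := 2 ^+ _; have x0 : x != 0 by rewrite expf_neq0 ?neq0.
(* One odd letter remains exactly when [q] is odd; its value xi h sends x e to 2 x xi e, which is
   non-zero. *)
have := size_drop q./2 (odd_letters S); rewrite size_odd_letters cS uphalf_half addnK.
case E : (drop _ _) => [|l [|]] //=; last by case: (odd q).
  by move=> _; apply/eqP => h; have [/eqP] := @b2X_eq0 F F0 _ h; rewrite (negPf x0).
move=> _.
have el : l = nth l (odd_letters S) q./2.
  by rewrite -[q./2]addn0 -nth_drop E.
have lq : (q./2 < size (odd_letters S))%N.
  by rewrite -subn_gt0 -size_drop E.
have lS : l \in odd_letters S by rewrite el mem_nth.
have -> : tableau_subst S t l = b2Y (sl_base F 2).
  have l1 : l.1 by case/mapP: lS => y _ ->.
  rewrite /tableau_subst l1 lS {1}el index_uniq ?odd_letters_uniq //.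
  by rewrite (row_of_out ht) // mulnC leq_trunc_div.
rewrite -[b2_br _ _ _]/(@lsa_br F L _ _) br_YX.
apply/eqP => /(congr1 (fun u : L => ursubmx (b2_val u))) /=.
rewrite block_mxKur => /matrixP /(_ ord0 ord0).
rewrite !mxE /= !(mulr0, mul0r, subr0, mul1r) => /eqP; rewrite oppr_eq0 mulf_eq0.
by rewrite (negPf x0) (negPf (neq0 1%N)).
Qed.

(** Non-zero determinants force [row_of t'] to take three distinct values on each column of [t], and
    the rearrangement inequality applies. *)
Lemma tableau_poly_eval_stat S t t' : #|S| = uphalf q ->
  is_tableau (3 * r) r r r t -> free_eval (tableau_subst S t') (tableau_poly S t) != 0 ->
  row_word (3 * r) t' = row_word (3 * r) t \/
  (word_stat (3 * r) (row_of t') < word_stat (3 * r) (row_of t))%N.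
Proof.
move=> cS ht.
rewrite (tableau_poly_eval (tau := fun i => sl_base F (row_of t' i)) _ _ _ ht) //; first last.
- by move=> i s im; apply: virtual_ads_eq.
- exact: tableau_subst_graded.
rewrite scaler_eq0 negb_or => /andP[/prodf_neq0 hp _].
apply: word_stat_lt => // [p|i ir]; first exact: row_of_lt3.
have := hp (Ordinal ir) isT; rewrite mulf_eq0 negb_or => /andP[_].
by rewrite sl_det_base ?row_of_lt3.
Qed.

Lemma partial_codim_ge :
  ('C(q, uphalf q) * size (tableaux (3 * r) r r r) <= partial_codim L k.+1 q)%N.
Proof.
set T := tableaux _ _ _ _.
pose I : finType := ({S : {set 'I_q} | #|S| == uphalf q} * 'I_(size T))%type.
have -> : ('C(q, uphalf q) * size T = #|I|)%N.
  have := card_draws 'I_q (uphalf q); rewrite card_prod card_sig !card_ord => <-.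
  by congr (_ * _)%N; apply: eq_card => S; rewrite !inE.
pose tab (i : I) := nth ([::], [::], [::]) T i.2.
have cS (i : I) : #|val i.1| = uphalf q by apply/eqP/(valP i.1).
have ht (i : I) : is_tableau (3 * r) r r r (tab i).
  by apply: tableauxP; rewrite ?leqnn // mem_nth.
pose f (i : I) := tableau_poly (val i.1) (tab i).
apply: (quo_dim_ge _ (partial_codimP L k.+1 q) (f := f)).
- have [W0 WP] := graded_Id_subspace L.
  have [U0 UP] := lspan_subspace [set f | exists2 w,
    perm_eq (letters w) (multi_letters k.+1 q) & f = monomial F w].
  by split=> // a u v [Uu Wu] [Uv Wv]; split; [apply: UP|apply: WP].
- by move=> i; apply: tableau_poly_multilinear.
move=> c [_ Idc].
apply: (triangular_free (stat := fun i => word_stat (3 * r) (row_of (tab i)))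
  (e := fun i j => free_eval (tableau_subst (val j.1) (tab j)) (f i))).
- by move=> j; apply: tableau_poly_eval_diag.
- move=> i j ij; have [eS|nS] := eqVneq (val i.1) (val j.1); last first.
    by rewrite tableau_poly_eval_neq ?eqxx.
  (* For equal halves, either the statistic drops or the row words agree; in the latter case the
     tableaux have the same index. *)
  rewrite -eS => /tableau_poly_eval_stat; case=> // ew.
  case/eqP: ij; case: i j eS ew => [Si i] [Sj j] /= /val_inj -> ew; congr (_, _).
  have u : uniq [seq row_word (3 * r) t | t <- T] by apply: uniq_row_words; rewrite leqnn.
  have [iT jT] : (i < size T)%N /\ (j < size T)%N by rewrite !ltn_ord.
  apply/ord_inj/eqP; rewrite -(nth_uniq [::] _ _ u) ?size_map //.
  by rewrite !(nth_map ([::], [::], [::])) //; apply/eqP/esym.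
- move=> j; rewrite -free_eval_sum; first exact/Idc/tableau_subst_graded.
  exact: tableau_subst_graded.
Qed.

End LowerBound.

(** * Central binomial coefficients *)

Lemma bin_le_central n i : ('C(n, i) <= 'C(n, uphalf n))%N.
Proof.
(* Both monotonicity claims compare j + 1 with n - j in (j + 1) C(n, j + 1) = (n - j) C(n, j). *)
have up j : (j < uphalf n)%N -> ('C(n, j) <= 'C(n, j.+1))%N.
  move=> jn; rewrite -(@leq_pmul2l j.+1) // mul_bin_left leq_mul2r.
  by apply/orP; right; move: jn; rewrite uphalf_half; have := odd_double_half n; lia.
have down j : (uphalf n <= j)%N -> ('C(n, j.+1) <= 'C(n, j))%N.
  move=> nj; rewrite -(@leq_pmul2l j.+1) // mul_bin_left leq_mul2r.
  by apply/orP; right; move: nj; rewrite uphalf_half; have := odd_double_half n; lia.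
have [ni|/ltnW] := leqP (uphalf n) i.
  rewrite -(subnKC ni); elim: (i - _)%N => [|d IH]; first by rewrite addn0.
  by rewrite addnS (leq_trans (down _ _)) // leq_addr.
move=> ni; rewrite -{1}(subKn ni).
elim: (uphalf n - i)%N (leq_subr i (uphalf n)) => [|d IH] hd; first by rewrite subn0.
apply: leq_trans (IH (ltnW hd)); apply: leq_trans (up _ _) _; first by lia.
by rewrite (_ : (uphalf n - d.+1).+1 = uphalf n - d)%N //; lia.
Qed.

Lemma central_bin_ge n : (2 ^ n <= n.+1 * 'C(n, uphalf n))%N.
Proof.
rewrite -[2%N]/(1 + 1)%N expnDn -[n.+1 in leqRHS]card_ord -sum_nat_const.
by apply: leq_sum => i _; rewrite !exp1n !muln1 bin_le_central.
Qed.

(** * Bounds for the graded codimensions *)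

Section Growth.
Variables (F : fieldType) (F0 : [pchar F] =i pred0) (R : realType).
Notation L := (b2 F0).
Notation s3 := (Num.sqrt 3 : R).
Notation alpha := (3 + 2 * s3).
Implicit Types k q n : nat.

Let s3_sqr : s3 ^+ 2 = 3.
Proof. by rewrite sqr_sqrtr. Qed.

Let s3_ge1 : 1 <= s3.
Proof. by rewrite -[leLHS]sqrtr1 ler_wsqrtr // ler1n. Qed.

Let s3_le2 : s3 <= 2.
Proof. by rewrite -ler_sqr ?nnegrE ?sqrtr_ge0 // s3_sqr; lra. Qed.

(** The binomial theorem sums the partial bounds; 32 is 16 times the bound 2 for sqrt 3. *)
Lemma gr_codim_le n : (gr_codim L n)%:R <= 32 * alpha ^+ n.
Proof.
rewrite addrC exprDn mulr_sumr natr_sum ler_sum // => i _.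
rewrite natrM mulrC -[X in 32 * X]mulr_natr mulrA ler_wpM2r //.
have := partial_codim_le F0 i (n - i); rewrite -(ler_nat R) !natrM natrX => /le_trans; apply.
have := card_balanced R (n - i).
set b := _%:R; set e := _ ^+ (n - i); move=> hb.
have e0 : 0 <= e by rewrite exprn_ge0 // mulr_ge0 // sqrtr_ge0.
have t0 : 0 <= 3 ^+ i :> R by rewrite exprn_ge0.
rewrite (_ : 32 * _ = 3 ^+ i * (2 * e) * 16); last by ring.
rewrite ler_wpM2r // ler_wpM2l //; apply: le_trans hb _.
by rewrite ler_wpM2r.
Qed.

(** The fifth power combines the central binomial (degree 1) and the tableau count (degree 4). In
    162 = 9 * 3 * 3 * 2, the factors come from rounding [m] down to [3 * r], the tableau count, the
    extra even letter, and halving [q]. *)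
Lemma partial_codim_lower k q :
  3 ^+ k.+1 * (2 * s3) ^+ q <= 162 * (k + q).+1%:R ^+ 5 * (partial_codim L k.+1 q)%:R.
Proof.
set P := partial_codim _ _ _; set m := (k + q./2)%N; set r := (m %/ 3)%N.
have nat_bound : (2 ^ q * 3 ^ m <= 27 * (k + q).+1 ^ 5 * P)%N.
  have hP := partial_codim_ge F0 k q; rewrite -/m -/r -/P in hP.
  have hT := size_square_tableaux r; have hC := central_bin_ge q.
  set T := size _ in hP hT; set C := 'C(_, _) in hP hC.
  have hm : (3 ^ m <= 9 * 27 ^ r)%N.
    rewrite -[9%N]/(3 ^ 2)%N -[27%N]/(3 ^ 3)%N -expnM -expnD leq_exp2l //.
    by have := divn_eq m 3; have := ltn_pmod m (isT : 0 < 3)%N; rewrite -/r; lia.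
  apply: (@leq_trans ((q.+1 * C) * (9 * (3 * r.+1 ^ 4 * T)))).
    by rewrite leq_mul // (leq_trans hm) // leq_mul2l.
  rewrite (_ : _ * _ = 27 * (q.+1 * r.+1 ^ 4) * (C * T))%N; last by ring.
  rewrite leq_mul // leq_mul2l /= [leqRHS]expnS leq_mul //; first by lia.
  rewrite leq_exp2r // ltnS; apply: leq_trans (leq_div m 3) _.
  by rewrite /m leq_add2l -{2}(odd_double_half q); lia.
have hs : s3 ^+ q <= 2 * 3 ^+ q./2.
  rewrite -[X in s3 ^+ X]odd_double_half exprD -mul2n exprM s3_sqr ler_wpM2r ?exprn_ge0 //.
  by case: (odd q); rewrite ?expr1 // expr0 ler1n.
rewrite exprMn.
have : (2 ^ q * 3 ^ m)%:R <= (27 * (k + q).+1 ^ 5 * P)%:R :> R by rewrite ler_nat.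
rewrite -[(k + q).+1%:R ^+ 5]natrX; move: (_ ^ 5)%N => x; rewrite !natrM !natrX /m exprD => h.
have : 2 ^+ q * 3 ^+ k * s3 ^+ q <= 2 ^+ q * 3 ^+ k * (2 * 3 ^+ q./2) :> R.
  by rewrite ler_wpM2l // mulr_ge0 // exprn_ge0.
rewrite exprS; move: h; move: (x%:R) (P%:R) (2 ^+ q) (3 ^+ k) (3 ^+ q./2) (s3 ^+ q).
move=> a b c d e f h1 h2; rewrite (_ : 3 * d * (c * f) = 3 * (c * d * f)); last by ring.
by rewrite (_ : 162 * a * b = 6 * (27 * a * b)); [lra|ring].
Qed.

Lemma gr_codim_ge n : (0 < n)%N -> alpha ^+ n <= 486 * n%:R ^+ 5 * (gr_codim L n)%:R.
Proof.
case: n => // n _.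
have a9 : alpha <= 9 by have := s3_le2; lra.
have h : 3 * alpha ^+ n <= 162 * n.+1%:R ^+ 5 * (gr_codim L n.+1)%:R.
  have -> : alpha ^+ n = \sum_(i < n.+1) 'C(n, i)%:R * (3 ^+ i * (2 * s3) ^+ (n - i)).
    by rewrite addrC exprDn; apply: eq_bigr => i _; rewrite -mulr_natl [_ * 3 ^+ _]mulrC.
  (* The term k = 0, to which the lower bound does not apply, is dropped; the others are compared
     through C(n, i) <= C(n + 1, i + 1). *)
  rewrite /gr_codim natr_sum [in leRHS]big_ord_recl mulrDr.
  apply: ler_wpDl; first by rewrite !mulr_ge0 // exprn_ge0.
  rewrite !mulr_sumr ler_sum // => i _; have ni : (i <= n)%N by rewrite -ltnS ltn_ord.
  have := partial_codim_lower i (n - i); rewrite subnKC // lift0 subSS exprS => h.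
  apply: (@le_trans _ _ ('C(n, i)%:R * (162 * n.+1%:R ^+ 5 * (partial_codim L i.+1 (n - i))%:R))).
    by rewrite mulrCA ler_wpM2l // mulrA.
  rewrite natrM mulrCA ler_wpM2l ?mulr_ge0 ?exprn_ge0 // ler_wpM2r //.
  by rewrite ler_nat binS leq_addl.
rewrite exprS; have : alpha * alpha ^+ n <= 9 * alpha ^+ n.
  by rewrite ler_wpM2r // exprn_ge0 //; have := s3_ge1; lra.
lra.
Qed.

End Growth.

(** * Convergence of the n-th root *)

Lemma root_cvg (R : realType) (c : nat -> R) (a A B : R) d : 0 < a -> 0 < A -> 0 < B ->
  (forall n, (0 < n)%N -> c n <= A * a ^+ n) ->
  (forall n, (0 < n)%N -> a ^+ n <= B * n%:R ^+ d * c n) ->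
  (fun n => c n `^ n%:R^-1) @ \oo --> a.
Proof.
move=> a0 A0 B0 cle cge.
have c0 n : (0 < n)%N -> 0 < c n.
  move=> n0; have X0 : 0 < B * n%:R ^+ d by rewrite mulr_gt0 // exprn_gt0 // ltr0n.
  rewrite -(pmulr_rgt0 _ X0).
  by apply: lt_le_trans (cge _ n0); rewrite exprn_gt0.
(* After taking logarithms, the errors are of order 1 / (n + 1) and ln (n + 1) / (n + 1); [u] bounds
   both up to constants. *)
pose u n : R := Num.sqrt n.+1%:R^-1.
have u0 n : 0 < u n by rewrite sqrtr_gt0 invr_gt0.
have u2 n : u n ^+ 2 = n.+1%:R^-1 by rewrite sqr_sqrtr // invr_ge0.
have u1 n : n.+1%:R^-1 <= u n.
  rewrite -u2 expr2 ger_pMr // -[leRHS]sqrtr1 ler_wsqrtr //.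
  by rewrite invf_le1 // ler1n.
have cvg_u : u @ \oo --> (0 : R).
  rewrite -sqrtr0; apply: (@continuous_cvg _ _ _ _ _ (@harmonic R) Num.sqrt).
    exact: sqrt_continuous.
  exact: cvg_harmonic.
pose g n : R := n.+1%:R^-1 * ln (c n.+1).
have cvg_g : g @ \oo --> ln a.
  apply: (@squeeze_cvgr _ _ _ _ (fun n => ln a - (`|ln B| + 2 * d%:R) * u n)
            (fun n => ln a + `|ln A| * u n)).
  - apply: nearW => n; rewrite /g.
    have n0 : 0 < n.+1%:R :> R by [].
    have iu k : 0 <= k -> n.+1%:R^-1 * k <= k * u n.
      by move=> k0; rewrite mulrC ler_wpM2l.
    apply/andP; split; last first.
      have : ln (c n.+1) <= ln A + ln a *+ n.+1.
        rewrite -lnXn // -lnM ?posrE ?exprn_gt0 //.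
        by rewrite ler_ln ?posrE ?mulr_gt0 ?exprn_gt0 ?c0 // cle.
      rewrite -(@ler_pM2l _ n.+1%:R^-1) ?invr_gt0 // => /le_trans; apply.
      rewrite -[ln a *+ _]mulr_natl mulrDr mulKf ?gt_eqF // addrC lerD2l.
      apply: le_trans (iu _ (normr_ge0 _)).
      by rewrite ler_wpM2l ?invr_ge0 // ler_norm.
    (* Here ln (n + 1) is twice the logarithm of sqrt (n + 1), which is bounded through ln (1 + x)
       <= x. *)
    have lnn : ln n.+1%:R <= 2 * (u n)^-1.
      have -> : n.+1%:R = (u n)^-1 ^+ 2 :> R by rewrite exprVn u2 invrK.
      rewrite lnXn ?invr_gt0 // -[ln _ *+ _]mulr_natl ler_wpM2l //.
      have := @le_ln1Dx R ((u n)^-1 - 1); rewrite [1 + _]addrC subrK => /(_ _) h.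
      by apply: le_trans (h _) _; [rewrite ltrBrDl subrr invr_gt0|rewrite gerBl].
    have : ln a *+ n.+1 <= ln B + ln n.+1%:R *+ d + ln (c n.+1).
      rewrite -!lnXn // -!lnM ?posrE ?mulr_gt0 ?exprn_gt0 ?c0 //.
      by rewrite ler_ln ?posrE ?mulr_gt0 ?exprn_gt0 ?c0 // cge.
    rewrite -(@ler_pM2l _ n.+1%:R^-1) ?invr_gt0 // -[ln a *+ _]mulr_natl mulKf ?gt_eqF // => h.
    rewrite lerBlDr; apply: le_trans h _; rewrite mulrDr addrC lerD2l mulrDr mulrDl lerD //.
      apply: le_trans (iu _ (normr_ge0 _)).
      by rewrite ler_wpM2l ?invr_ge0 // ler_norm.
    have l2 : n.+1%:R^-1 * ln n.+1%:R <= 2 * u n.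
      rewrite (_ : 2 * u n = n.+1%:R^-1 * (2 * (u n)^-1)) ?ler_wpM2l ?invr_ge0 //.
      by rewrite -u2 mulrCA expr2 mulfK ?gt_eqF.
    rewrite -[ln _ *+ _]mulr_natl mulrCA.
    by rewrite (_ : 2 * d%:R * u n = d%:R * (2 * u n)) ?ler_wpM2l //; ring.
  - rewrite -[X in _ --> X]subr0 -[X in _ - X](mulr0 (`|ln B| + 2 * d%:R)).
    by apply: cvgB; [exact: cvg_cst|apply: cvgM => //; exact: cvg_cst].
  - rewrite -[X in _ --> X]addr0 -[X in _ + X](mulr0 `|ln A|).
    by apply: cvgD; [exact: cvg_cst|apply: cvgM => //; exact: cvg_cst].
(* The bounds start at n = 1, hence the shift. *)
rewrite -cvg_shiftS -[a]lnK ?posrE //.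
have -> : [sequence c n.+1 `^ n.+1%:R^-1]_n = expR \o g.
  by apply/funext => n; rewrite /= /powR gt_eqF // c0.
apply: continuous_cvg cvg_g; exact: continuous_expR.
Qed.

Theorem theorem1 (F : fieldType) (F0 : [pchar F] =i pred0) (R : realType) :
  (fun n : nat => ((gr_codim (b2 F0) n)%:R : R) `^ (n%:R^-1)) @ \oo
    --> (3 + 2 * Num.sqrt 3 : R).
Proof.
apply: (@root_cvg R (fun n => (gr_codim (b2 F0) n)%:R) _ 32 486 5).
- by rewrite addr_gt0 // mulr_gt0 // sqrtr_gt0.
- by [].
- by [].
- by move=> n _; apply: gr_codim_le.
- exact: gr_codim_ge.
Qed.
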